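(* Let $L_d$ be the multirate discretisation of the Lagrangian $L$ based on polynomials of degree $l$ and a quadrature rule of order $u$, i.e. $$L_d(q_0,q_1)=\operatorname*{ext}_{(\hat q^s,\check q^f)}\ \Delta t\sum_{m=0}^{p-1}\sum_{i=1}^rb_i\,L\big(\hat q^s(\tau_{m,i}),\check q^f(\tau_{m,i}),\dot{\hat q}^s(\tau_{m,i}),\dot{\check q}^f(\tau_{m,i})\big),\qquad \tau_{m,i}=m\Delta t+c_i\Delta t,$$ the extremum being over $\hat q^s\in\mathcal P^l([0,\Delta T],Q^s)$ and $\check q^f\in\mathcal P^l_p([0,\Delta T],Q^f)$ with $\hat q^s(0)=q_0^s$, $\hat q^s(\Delta T)=q_1^s$, $\check q^f(0)=q_0^{f}$, $\check q^f(\Delta T)=q_1^{f}$, where $q_0=(q_0^s,q_0^f)$, $q_1=(q_1^s,q_1^f)$. Assume that all discrete and continuous critical curves minimise their respective actions, and that these minimisers are unique. Then the difference between the discrete and the exact discrete Lagrangian is $$L_d(q(0),q(\Delta T))=L_d^E(q(0),q(\Delta T))+\mathcal O\big((\Delta T)^{2l+1}\big)+p\,\mathcal O\big((\Delta t)^{u+1}\big).$$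
   Context: $Q=Q^s\times Q^f$ is an open subset of $\mathbb{R}^{n^s}\times\mathbb{R}^{n^f}$ (slow and fast variables). $L$ is the smooth regular multirate Lagrangian $L(q^s,q^f,\dot q^s,\dot q^f)=\tfrac12(\dot q^s)^TM^s\dot q^s+\tfrac12(\dot q^f)^TM^f\dot q^f-V(q^s,q^f)-W(q^f)$; also written $L(q,\dot q)$ with $q=(q^s,q^f)$. The macro step is $\Delta T=p\,\Delta t$, with $p\in\mathbb{N}$ the number of micro steps; the asymptotics are for $\Delta T\to0$. $\mathcal P^l([a,b],Q')$ is the space of polynomial curves $[a,b]\to Q'$ of degree at most $l$. $\mathcal P^l_p([0,\Delta T],Q')$ is the space of continuous curves $[0,\Delta T]\to Q'$ whose restriction to each micro interval $[m\Delta t,(m+1)\Delta t]$, $m=0,\dots,p-1$, is a polynomial of degree at most $l$. The quadrature rule has points $c_i\in[0,1]$ and weights $b_i\in\mathbb{R}$, $i=1,\dots,r$, with $\sum_ib_i=1$; it has order $u$ (the paper also says ''degree $u$'') meaning that for every smooth $f$, $\int_0^{h}f(t)\,dt-h\sum_ib_if(hc_i)=\mathcal O(h^{u+1})$. The exact discrete Lagrangian is $L_d^E(q_0,q_1)=L_d^E(q_0,q_1,\Delta T)=\int_0^{\Delta T}L(q(t),\dot q(t))\,dt$, for sufficiently small $\Delta T$ and close $q_0,q_1$, where $q$ is the unique solution of the Euler-Lagrange equations of $L$ with $q(0)=q_0$, $q(\Delta T)=q_1$. The continuous action of a curve on $[0,\Delta T]$ with given end points is $\int_0^{\Delta T}L\,dt$;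 the discrete action of a pair $(\hat q^s,\check q^f)$ is the double sum in the definition of $L_d$.
   Formalization: The constant in the term p·O((Δt)^{u+1}) is allowed to depend on an assumed bound K for the u-th time derivative of the integrand L along the discrete critical curve on the micro intervals; without such a bound the claim fails (e.g. midpoint rule, l=2, p=1). *)

(* Defs.v *)
From HB Require Import structures.
From mathcomp Require Import all_boot all_order all_algebra.
From mathcomp Require Import all_classical all_reals all_analysis.

Set Implicit Arguments.
Unset Strict Implicit.
Unset Printing Implicit Defensive.

Import Order.TTheory GRing.Theory Num.Theory.
Import numFieldNormedType.Exports.

Local Open Scope classical_set_scope.
Local Open Scope ring_scope.

Section Smoothness.
Context {R : realType}.

(* For open [U] this is the usual class C^k: [f] is C^(k+1) iff it is
   differentiable with all its directional derivatives of class C^k. *)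
Fixpoint Ck_on {E : normedModType R} (k : nat) (U : set E) (f : E -> R) :
    Prop :=
  match k with
  | 0 => forall x, U x -> {for x, continuous f}
  | k'.+1 => (forall x, U x -> differentiable f x) /\
             forall w, Ck_on k' U (fun x => 'D_w f x)
  end.

Definition smooth_on {E : normedModType R} (U : set E) (f : E -> R) : Prop :=
  forall k, Ck_on k U f.

Definition smooth_line (f : R -> R) : Prop :=
  forall n x, derivable (derive1n n f) x 1.

(* C^1 on the closed interval [a, b], one-sided derivatives at the end points
   included: [q] agrees there with a C^1 function on the whole line. *)
Definition C1_on {E : normedModType R} (a b : R) (q : R -> E) : Prop :=
  exists g : R -> E,
    [/\ forall t, derivable g t 1, continuous (derive1 g) &
        forall t, a <= t <= b -> q t = g t].

Definition piecewise_C1 {E : normedModType R} (h : R) (q : R -> E) : Prop :=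
  exists (k : nat) (s : nat -> R),
    [/\ s 0%N = 0, s k = h, forall j, (j < k)%N -> s j < s j.+1 &
        forall j, (j < k)%N -> C1_on (s j) (s j.+1) q].

End Smoothness.

Section Quadrature.
Context {R : realType}.

Definition quadrature_order (r : nat) (b c : 'I_r -> R) (u : nat) : Prop :=
  forall f : R -> R, smooth_line f ->
    exists C h0 : R, 0 < h0 /\
      forall h : R, 0 < h -> h <= h0 ->
        `| Rintegral lebesgue_measure `[0, h] f
           - h * \sum_(i < r) b i * f (h * c i) | <= C * h ^+ u.+1.

End Quadrature.

Section ContinuousMechanics.
Context {R : realType} {E : normedModType R}.
(* A Lagrangian is a function of the pair (position, velocity).  A curve on
   [0, h] is a function on R of which only the restriction to [0, h] matters. *)
Implicit Types (Q : set E) (L : E * E -> R) (h : R) (q : R -> E).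

(* The second partial derivative of [L] in the velocities is a nondegenerate
   bilinear form at every state. *)
Definition regular_lagrangian Q L : Prop :=
  forall x v : E, Q x -> forall w : E,
    (forall w' : E, 'D_(0, w') (fun z => 'D_(0, w) L z) (x, v) = 0) -> w = 0.

(* d/dt (dL/dv) = dL/dq, tested against every constant direction [w]. *)
Definition EL_solution Q L h q : Prop :=
  [/\ C1_on 0 h q,
      forall t, 0 <= t <= h -> Q (q t) &
      forall t, 0 < t < h -> forall w : E,
        is_derive t 1 (fun s => 'D_(0, w) L (q s, derive1 q s))
                      ('D_(w, 0) L (q t, derive1 q t))].

Definition EL_boundary_solution Q L h (q0 q1 : E) q : Prop :=
  [/\ EL_solution Q L h q, q 0 = q0 & q h = q1].

(* The finitely many kinks of a piecewise C^1 curve, where [derive1] is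
   meaningless, do not contribute to the integral. *)
Definition action L h q : R :=
  Rintegral lebesgue_measure `[0, h] (fun t => L (q t, derive1 q t)).

(* [get] selects the solution, which is unique on [0, h] in the situation where
   the exact discrete Lagrangian is considered. *)
Definition exact_discrete_lagrangian Q L h (q0 q1 : E) : R :=
  action L h (get [set q : R -> E | EL_boundary_solution Q L h q0 q1 q]).

Definition admissible_curve Q h (q0 q1 : E) q : Prop :=
  [/\ piecewise_C1 h q, forall t, 0 <= t <= h -> Q (q t), q 0 = q0 &
      q h = q1].

Definition curve_variation h (d : R -> E) : Prop :=
  [/\ piecewise_C1 h d, d 0 = 0 & d h = 0].

Definition critical_curve Q L h (q0 q1 : E) q : Prop :=
  admissible_curve Q h q0 q1 q /\
  forall d, curve_variation h d ->
    is_derive (0 : R) 1 (fun e : R => action L h (fun t => q t + e *: d t)) 0.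

Definition minimising_curve Q L h (q0 q1 : E) q : Prop :=
  admissible_curve Q h q0 q1 q /\
  forall q', admissible_curve Q h q0 q1 q' -> action L h q <= action L h q'.

Definition critical_curves_minimise Q L h (q0 q1 : E) : Prop :=
  (forall q, critical_curve Q L h q0 q1 q -> minimising_curve Q L h q0 q1 q) /\
  (forall q q', minimising_curve Q L h q0 q1 q ->
     minimising_curve Q L h q0 q1 q' -> forall t, 0 <= t <= h -> q t = q' t).

End ContinuousMechanics.

Definition multirate_lagrangian {R : realType} {ns nf : nat}
    (Ms : 'M[R]_ns) (Mf : 'M[R]_nf)
    (V : 'cV[R]_ns * 'cV[R]_nf -> R) (W : 'cV[R]_nf -> R)
    (z : ('cV[R]_ns * 'cV[R]_nf) * ('cV[R]_ns * 'cV[R]_nf)) : R :=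
  2^-1 * ((z.2.1)^T *m Ms *m z.2.1) 0 0
  + 2^-1 * ((z.2.2)^T *m Mf *m z.2.2) 0 0
  - V z.1 - W z.1.2.

Section MultirateDiscretisation.
Context {R : realType} {ns nf : nat}.
Local Notation E := ('cV[R]_ns * 'cV[R]_nf)%type.

Definition pvalue {n} (P : 'cV[{poly R}]_n) (t : R) : 'cV[R]_n :=
  map_mx (fun a : {poly R} => a.[t]) P.

Definition pvelocity {n} (P : 'cV[{poly R}]_n) (t : R) : 'cV[R]_n :=
  map_mx (fun a : {poly R} => (deriv a).[t]) P.

Definition deg_le {n} (l : nat) (P : 'cV[{poly R}]_n) : Prop :=
  forall i, (size (P i ord0) <= l.+1)%N.

(* A pair (slow curve, fast curve).  The fast curve is given by its polynomial
   piece on each micro interval, as a function of the global time: at a micro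
   node, where a quadrature point may lie, the velocity depends on the piece. *)
Definition dcurve (p : nat) : Type :=
  ('cV[{poly R}]_ns * {ffun 'I_p -> 'cV[{poly R}]_nf})%type.

Definition dposition {p} (x : dcurve p) (m : 'I_p) (t : R) : E :=
  (pvalue x.1 t, pvalue (x.2 m) t).

Definition dvelocity {p} (x : dcurve p) (m : 'I_p) (t : R) : E :=
  (pvelocity x.1 t, pvelocity (x.2 m) t).

Definition in_micro (dt : R) (m : nat) (t : R) : Prop :=
  m%:R * dt <= t <= m.+1%:R * dt.

Definition multirate_space (l p : nat) (dt : R) (x : dcurve p) : Prop :=
  [/\ deg_le l x.1, forall m, deg_le l (x.2 m) &
      forall m m' : 'I_p, m' = m.+1 :> nat ->
        pvalue (x.2 m) (m'%:R * dt) = pvalue (x.2 m') (m'%:R * dt)].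

Definition dboundary (p : nat) (dt : R) (q0 q1 : E) (x : dcurve p) : Prop :=
  (forall m : 'I_p, m = 0%N :> nat -> dposition x m 0 = q0) /\
  (forall m : 'I_p, m.+1 = p -> dposition x m (p%:R * dt) = q1).

Definition dadmissible (Q : set E) (l p : nat) (dt : R) (q0 q1 : E)
    (x : dcurve p) : Prop :=
  [/\ multirate_space l dt x,
      forall (m : 'I_p) t, in_micro dt m t -> Q (dposition x m t) &
      dboundary dt q0 q1 x].

Definition dvariation (l p : nat) (dt : R) (d : dcurve p) : Prop :=
  multirate_space l dt d /\ dboundary dt 0 0 d.

Definition dperturb {p} (x d : dcurve p) (e : R) : dcurve p :=
  (x.1 + e%:P *: d.1, [ffun m => x.2 m + e%:P *: d.2 m]).

Definition dintegrand (L : E * E -> R) {p} (x : dcurve p) (m : 'I_p) (t : R) :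
    R :=
  L (dposition x m t, dvelocity x m t).

Definition discrete_action (L : E * E -> R) {r} (b c : 'I_r -> R) {p}
    (dt : R) (x : dcurve p) : R :=
  dt * \sum_(m < p) \sum_(i < r)
         b i * dintegrand L x m (m%:R * dt + c i * dt).

Section Extremum.
Context (Q : set E) (L : E * E -> R) (l r : nat) (b c : 'I_r -> R).
Context (p : nat) (dt : R) (q0 q1 : E).

Definition dcritical (x : dcurve p) : Prop :=
  dadmissible Q l dt q0 q1 x /\
  forall d : dcurve p, dvariation l dt d ->
    is_derive (0 : R) 1
      (fun e : R => discrete_action L b c dt (dperturb x d e)) 0.

Definition dminimising (x : dcurve p) : Prop :=
  dadmissible Q l dt q0 q1 x /\
  forall y : dcurve p, dadmissible Q l dt q0 q1 y ->
    discrete_action L b c dt x <= discrete_action L b c dt y.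

Definition dcritical_minimise : Prop :=
  (forall x, dcritical x -> dminimising x) /\
  (forall x y, dminimising x -> dminimising y -> x = y).

(* [v] is the extremum L_d(q0, q1): a stationary value of the discrete action. *)
Definition is_discrete_lagrangian (v : R) : Prop :=
  exists2 x, dcritical x & v = discrete_action L b c dt x.

(* The order of the quadrature rule bounds its error on one fixed integrand.
   Here the integrand is L along the discrete critical curve, which varies with
   p and dt; [K] is the bound on its u-th derivative on which the constant in
   the quadrature remainder depends. *)
Definition integrand_derivative_bounded (u : nat) (K : R) : Prop :=
  forall x, dcritical x ->
    forall (m : 'I_p) t, m%:R * dt < t < m.+1%:R * dt ->
      `| derive1n u (dintegrand L x m) t | <= K.

End Extremum.

End MultirateDiscretisation.

(* Main.v *)
Require Import Defs.
From HB Require Import structures.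
From mathcomp Require Import all_boot all_order all_algebra.
From mathcomp Require Import all_classical all_reals all_analysis.
From mathcomp Require Import ring lra.
Import Order.TTheory GRing.Theory Num.Theory.
Import numFieldNormedType.Exports.
Set Implicit Arguments.
Unset Strict Implicit.
Unset Printing Implicit Defensive.
Local Open Scope classical_set_scope.
Local Open Scope ring_scope.

(** Write L(x, v) = B(v, v)/2 - U(x).  For a solution q of the Euler-Lagrange
    equations the momentum p has derivative - grad U(q), so in
    L(z, z') - L(q, q') the part linear in d = z - q is (p . d)', which
    integrates to 0 when d vanishes at both ends.  Hence the action of a curve z
    with |z - q| = O(h^(l+1)) and |z' - q'| = O(h^l) differs from that of q by
    O(h^(2l+1)), and Euler-Lagrange solutions are critical, hence minimising.

    Let x be the discrete critical curve and y the curve of degree l made of a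
    Taylor polynomial of q and an affine correction of its end points.  With S
    the action and S_d the discrete action, minimality gives
      S(q) <= S(x) = S_d(x) + error  and  S_d(x) <= S_d(y) = S(y) + error
           <= S(q) + O(h^(2l+1)) + error,
    where each error is that of the quadrature on p micro intervals. *)

(** Every bound has to be uniform in the macro step [h], although [y] is a different polynomial for
    each [h]. So [h] is kept as a parameter and derivatives are controlled along the filter of pairs
    [(h, t)] with [0 < t < h] and [h] tending to 0; this gives one bound for the [u]-th derivative
    of L along all the curves [y]. For [x] the corresponding bound is the assumed [K]. The order of
    the quadrature rule speaks of one fixed integrand at a time. Tested on monomials it yields
    exactness in degree below [u], and exactness yields a remainder that depends on the integrand
    only through its [u]-th derivative. By definition a solution [q] is only C^1. Its regularity is
    bootstrapped: the velocity is a linear function of the momentum, whose derivative is a smooth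
    function of [q]. The affine correction has degree 1, too much for [l = 0]; but then the
    existence of an admissible discrete curve forces equal end points, and the linear term vanishes.
    Velocities jump at finitely many times, so actions are handled through primitives and a mean
    value inequality that tolerates a finite exceptional set. *)

Section OneVariable.
Context {R : realType}.
Implicit Types (f F : R -> R) (a b : R) (p : {poly R}).

Lemma continuous_subitv f a b c d : {within `[a, b], continuous f} ->
  a <= c -> d <= b -> {within `[c, d], continuous f}.
Proof.
move=> cf ac db; apply: continuous_subspaceW cf => t /=.
rewrite !in_itv/= => /andP[ct td].
by rewrite (le_trans ac ct) (le_trans td db).
Qed.

(** The list [S] collects the kinks at which a primitive may fail to be differentiable. By induction
    on it, the interval is cut at an exceptional point lying inside, and the two estimates add
    up. *)
Lemma mean_value_le (S : seq R) F f M a b : a <= b ->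
  {within `[a, b], continuous F} ->
  (forall t, a < t < b -> t \notin S -> is_derive t 1 F (f t)) ->
  (forall t, a < t < b -> t \notin S -> `|f t| <= M) ->
  `|F b - F a| <= M * (b - a).
Proof.
elim: S a b => [|s S IH] a b ab cF dF fM.
  move: ab; rewrite le_eqVlt => /predU1P[->|ab].
    by rewrite !subrr normr0 mulr0.
  have [t|t /itvP tab ->] := @MVT R F f a b ab _ cF.
    by rewrite in_itv => /= tab; apply: dF.
  by rewrite normrM [`|b - a|]ger0_norm ?subr_ge0 ?(ltW ab)// ler_wpM2r
    ?subr_ge0 ?(ltW ab)// fM ?tab.
have [/andP[as' sb]|nsab] := boolP (a < s < b); last first.
  apply: IH => // t tab tS; [apply: dF | apply: fM] => //;
  rewrite inE negb_or tS andbT; apply: contraNneq nsab => <- //.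
have -> : F b - F a = (F b - F s) + (F s - F a) by ring.
apply: le_trans (ler_normD _ _) _.
have -> : M * (b - a) = M * (b - s) + M * (s - a) by ring.
apply: lerD; apply: IH; rewrite ?(ltW as') ?(ltW sb)//.
- exact: (continuous_subitv cF (ltW as') (lexx _)).
- move=> t /andP[st tb] tS; apply: dF; first by rewrite (lt_trans as' st).
  by rewrite inE negb_or tS andbT gt_eqF.
- move=> t /andP[st tb] tS; apply: fM; first by rewrite (lt_trans as' st).
  by rewrite inE negb_or tS andbT gt_eqF.
- exact: (continuous_subitv cF (lexx _) (ltW sb)).
- move=> t /andP[st tb] tS; apply: dF; first by rewrite st (lt_trans tb sb).
  by rewrite inE negb_or tS andbT lt_eqF.
- move=> t /andP[st tb] tS; apply: fM; first by rewrite st (lt_trans tb sb).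
  by rewrite inE negb_or tS andbT lt_eqF.
Qed.

Lemma mean_value_le_dist F f M a b s t : a < s < b -> a < t < b ->
  (forall x, a < x < b -> is_derive x 1 F (f x)) ->
  (forall x, Num.min s t < x < Num.max s t -> `|f x| <= M) ->
  `|F t - F s| <= M * `|t - s|.
Proof.
wlog st : s t / s <= t.
  move=> H sab tab dF fM; have [st|/ltW ts] := leP s t; first exact: H.
  rewrite distrC (distrC t); apply: H => // x.
  by rewrite minC maxC; exact: fM.
move=> /andP[as' sb] /andP[at' tb] dF fM.
rewrite (ger0_norm (x := t - s)) ?subr_ge0//.
apply: (@mean_value_le [::] F f) => //.
- apply: derivable_within_continuous => x; rewrite in_itv/= => /andP[sx xt].
  by apply: (ex_derive (is_derive := dF _ _));
    rewrite (lt_le_trans as' sx) (le_lt_trans xt tb).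
- move=> x /andP[sx xt] _.
  by apply: dF; rewrite (lt_trans as' sx) (lt_trans xt tb).
- by move=> x sxt _; apply: fM; rewrite min_l// max_r.
Qed.

(** With [n] terms the degree is below [n], so the remainder has order [n], and degree [l]
    corresponds to [taylor l.+1]. *)
Definition taylor n f (m : R) : {poly R} :=
  \sum_(k < n) (derive1n k f m / k`!%:R) *: ('X - m%:P) ^+ k.

Lemma size_taylor n f m : (size (taylor n f m) <= n)%N.
Proof.
apply: (leq_trans (size_sum _ _ _)); apply/bigmax_leqP => k _.
apply: (leq_trans (size_scale_leq _ _)).
by apply: (leq_trans (size_poly_exp_leq _ _)); rewrite size_XsubC mul1n.
Qed.

Lemma deriv_taylor n f m : (taylor n.+1 f m)^`() = taylor n (derive1 f) m.
Proof.
rewrite /taylor big_ord_recl/= expr0 derivD derivZ derivC scaler0 add0r.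
rewrite raddf_sum/=; apply: eq_bigr => k _.
rewrite derivZ deriv_exp derivXsubC mul1r -scalerMnr scalerMnl -mulr_natr.
rewrite -derive1Sn /bump/= add0n factS natrM; congr (_ *: _).
by field; rewrite addrC natr1 !pnatr_eq0 -lt0n fact_gt0.
Qed.

Lemma horner_taylor_center n f m : (taylor n.+1 f m).[m] = f m.
Proof.
rewrite /taylor big_ord_recl/= hornerD hornerZ expr0 hornerC fact0 divr1 mulr1.
rewrite horner_sum big1 ?addr0// => k _.
by rewrite hornerZ horner_exp hornerXsubC subrr expr0n/= mulr0.
Qed.

(** The derivative of the remainder is the remainder of the derivative, one order lower, so the mean
    value inequality is iterated [n] times. Each iteration uses only the largest value on the
    segment, hence the constant [C] without division by a factorial. *)
Lemma taylor_remainder n f a b m C : a < m < b ->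
  (forall k t, (k < n)%N -> a < t < b -> derivable (derive1n k f) t 1) ->
  (forall t, a < t < b -> `|derive1n n f t| <= C) ->
  forall t, a < t < b -> `|f t - (taylor n f m).[t]| <= C * `|t - m| ^+ n.
Proof.
move=> amb; elim: n f => [|n IH] f df fC t atb.
  by rewrite /taylor big_ord0 horner0 subr0 expr0 mulr1; exact: fC.
have dg x : a < x < b -> is_derive x 1
    (f - horner (taylor n.+1 f m)) (derive1 f x - (taylor n (derive1 f) m).[x]).
  move=> axb; rewrite -deriv_taylor derive1E; apply: is_deriveB.
  by apply/derivableP; exact: (df 0%N).
have := @mean_value_le_dist (f - horner (taylor n.+1 f m)) _ (C * `|t - m| ^+ n)
  a b m t amb atb dg.
rewrite !fctE horner_taylor_center subrr subr0 -mulrA -exprSr; apply.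
move=> x /andP[lx xu].
have axb : a < x < b.
  case/andP: amb => am mb; case/andP: atb => at' tb.
  by rewrite (le_lt_trans _ lx) ?le_min ?am ?at' ?lt_min ?am ?(lt_le_trans xu)
    ?ge_max ?(ltW mb) ?(ltW tb) ?(ltW am) ?(ltW at').
apply: (le_trans (IH (derive1 f) _ _ x axb)).
- by move=> k s kn asb; rewrite -derive1Sn; exact: df.
- by move=> s asb; rewrite -derive1Sn; exact: fC.
have C0 : 0 <= C by apply: le_trans (fC _ amb).
apply: ler_wpM2l => //; rewrite lerXn2r ?nnegrE//.
move: lx xu; have [mt|tm] := leP m t; rewrite ?minElt ?maxElt => lx xu.
  by rewrite !ger0_norm ?subr_ge0// ?lerB// ?(ltW xu) ?(ltW lx).
by rewrite !ler0_norm ?subr_le0 ?lerN2 ?lerB ?(ltW xu) ?(ltW lx) ?(ltW tm).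
Qed.

Lemma smooth_line_horner p : smooth_line (horner p).
Proof.
move=> n; suff -> : derive1n n (horner p) = horner (derivn n p).
  by move=> x; exact: derivable_horner.
by elim: n => [//|n IH]; rewrite derive1nS IH derivnS derivE.
Qed.

Definition antideriv p : {poly R} :=
  \sum_(i < size p) (p`_i / i.+1%:R) *: 'X^(i.+1).

Lemma deriv_antideriv p : (antideriv p)^`() = p.
Proof.
rewrite raddf_sum/= -[RHS]coefK poly_def; apply: eq_bigr => i _.
by rewrite derivZ derivXn -scalerMnr scalerMnl -mulr_natr divfK ?pnatr_eq0.
Qed.

(** Taylor estimates hold inside an interval, but are also needed at its ends, where quadrature
    points may lie and end values are interpolated. *)
Lemma le_norm_closed f C a b : a < b ->
  {within `[a, b], continuous f} ->
  (forall t, a < t < b -> `|f t| <= C) ->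
  forall t, a <= t <= b -> `|f t| <= C.
Proof.
move=> ab /(continuous_within_itvP _ ab)[_ fa fb] fC t /andP[].
rewrite le_eqVlt => /predU1P[<- _|at'].
  have cvf : `|f x| @[x --> a^'+] --> `|f a| by exact: cvg_norm.
  rewrite -(cvg_lim _ cvf)//.
  apply: limr_le; first by apply/cvg_ex; exists `|f a|.
  near=> x; apply: fC; apply/andP; split; near: x.
    exact: nbhs_right_gt.
  exact: nbhs_right_lt.
rewrite le_eqVlt => /predU1P[->|tb]; last by rewrite fC ?at'.
have cvf : `|f x| @[x --> b^'-] --> `|f b| by exact: cvg_norm.
rewrite -(cvg_lim _ cvf)//.
apply: limr_le; first by apply/cvg_ex; exists `|f b|.
near=> x; apply: fC; apply/andP; split; near: x.
  exact: nbhs_left_gt.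
exact: nbhs_left_lt.
Unshelve. all: by end_near. Qed.

Lemma Rintegral_horner p (h : R) : 0 < h ->
  Rintegral lebesgue_measure `[0, h] (horner p) =
  (antideriv p).[h] - (antideriv p).[0].
Proof.
move=> h0; rewrite /Rintegral.
have cH (p0 : {poly R}) : {within `[0, h], continuous (horner p0)}.
  by apply: continuous_subspaceT; exact: continuous_horner.
rewrite (@continuous_FTC2 _ _ (horner (antideriv p)) 0 h) //.
  split=> [x _||]; first exact: derivable_horner.
    apply: cvg_at_right_filter; exact: continuous_horner.
  apply: cvg_at_left_filter; exact: continuous_horner.
by move=> x _; rewrite -[X in _ = horner X x]deriv_antideriv derivE.
Qed.

End OneVariable.

(** * Uniform error bound for a quadrature rule of given order *)

Section Quadrature.
Context {R : realType} (r u : nat) (b c : 'I_r -> R).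
Context (orderu : quadrature_order b c u).

(** On the monomial t^j the integral and the rule both scale like h^(j+1), so their difference is
    exactly a constant times h^(j+1). Being O(h^(u+1)) with [j < u], it has constant 0. *)
Lemma quadrature_moment j : (j < u)%N ->
  \sum_(i < r) b i * c i ^+ j = j.+1%:R^-1.
Proof.
move=> ju; have [C [h0 [h0p hC]]] := orderu (smooth_line_horner (p := 'X^j)).
set D := \sum_(i < r) _; apply/eqP; rewrite eq_sym -subr_eq0 -normr_le0.
rewrite leNgt; apply/negP; set d := `| _ | => d0.
(* The bound 1 gives h^(u-j) <= h, and the last bound gives (|C| + 1) h <= d / 2 < d, against d <=
   |C| h^(u-j). *)
pose h := Num.min h0 (Num.min 1 (d / (2 * (`|C| + 1)))).
have hp : 0 < h.
  by rewrite !lt_min h0p ltr01/= divr_gt0// mulr_gt0// ltr_wpDl.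
have hh0 : h <= h0 by rewrite ge_min lexx.
have h1 : h <= 1 by rewrite !ge_min lexx orbT.
have hd : h <= d / (2 * (`|C| + 1)) by rewrite !ge_min lexx !orbT.
have {hC} := hC h hp hh0; rewrite Rintegral_horner//.
have adX (x : R) : (antideriv 'X^j).[x] = x ^+ j.+1 / j.+1%:R.
  rewrite /antideriv size_polyXn big_ord_recr/= hornerD horner_sum big1 ?add0r.
    by rewrite coefXn eqxx hornerZ hornerXn mulrC div1r.
  by move=> i _; rewrite coefXn (ltn_eqF (ltn_ord i)) mul0r scale0r horner0.
rewrite !adX expr0n/= mul0r subr0.
have -> : h * \sum_(i < r) b i * ('X^j).[h * c i] = h ^+ j.+1 * D.
  rewrite exprS -mulrA; congr (_ * _); rewrite mulr_sumr; apply: eq_bigr => i _.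
  by rewrite hornerXn exprMn mulrCA.
rewrite -mulrBr normrM -/d ger0_norm ?exprn_ge0 ?(ltW hp)//.
apply/negP; rewrite -ltNge.
have -> : u.+1 = (j.+1 + (u - j).-1.+1)%N.
  by rewrite prednK ?subn_gt0// addSn subnKC// ltnW.
rewrite exprD mulrCA ltr_pM2l ?exprn_gt0//.
have hC : 0 < `|C| + 1 by rewrite ltr_wpDl.
apply: (@le_lt_trans _ _ ((`|C| + 1) * h)).
  apply: (@le_trans _ _ (`|C| * h ^+ (u - j).-1.+1)).
    by rewrite ler_wpM2r ?exprn_ge0 ?(ltW hp)// ler_norm.
  apply: ler_pM; rewrite ?exprn_ge0 ?(ltW hp)// ?lerDl//.
  by rewrite exprS ler_piMr ?(ltW hp)// exprn_ile1 ?(ltW hp).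
apply: (@le_lt_trans _ _ (d / 2)); last by rewrite ltr_pdivrMr// ltr_pMr// ltr1n.
rewrite mulrC -ler_pdivlMr//; apply: (le_trans hd).
by rewrite invfM mulrA.
Qed.

(** Rescaled to [0, 1], both sides are linear in the coefficients, and the moments settle each
    monomial. The integral is expressed by a primitive, in the form that the mean value inequality
    needs. *)
Lemma quadrature_exact (p : {poly R}) (a dt : R) : (size p <= u)%N -> 0 < dt ->
  exists2 P : {poly R}, forall t, P^`().[t] = p.[t] &
    P.[a + dt] - P.[a] = dt * \sum_(i < r) b i * p.[a + c i * dt].
Proof.
move=> pu dt0.
pose s := p \Po (dt *: 'X + a%:P).
have su : (size s <= u)%N.
  have [p0|p0] := eqVneq p 0; first by rewrite /s p0 comp_poly0 size_poly0.
  apply: (leq_trans (size_comp_poly_leq _ _)).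
  move: p0 pu; rewrite -size_poly_eq0; case: (size p) => // n _ nu.
  rewrite /= (leq_trans _ nu)// ltnS -[X in (_ <= X)%N]muln1 leq_mul2l.
  have : (size (dt *: 'X + a%:P)%R <= 2)%N.
    apply: (leq_trans (size_polyD _ _)); rewrite geq_max.
    by rewrite (leq_trans (size_scale_leq _ _)) ?size_polyX// size_polyC; case: (a != 0).
  by case: size => [|[|[|]]]; rewrite ?orbT.
have sE x : s.[x] = p.[a + x * dt].
  by rewrite horner_comp !hornerE mulrC addrC.
pose A := antideriv s; pose v := dt^-1 *: 'X - (a / dt)%:P.
have vE t : v.[t] = (t - a) / dt by rewrite !hornerE mulrBl mulrC.
exists (dt *: (A \Po v)) => [t|].
  rewrite derivZ deriv_comp deriv_antideriv !hornerE horner_comp vE.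
  rewrite derivB derivC derivZ derivX subr0 !hornerE sE.
  by rewrite divfK ?gt_eqF// addrC subrK /= mulr1 mulrAC divff ?gt_eqF// mul1r.
rewrite !hornerZ !horner_comp !vE subrr mul0r addrAC subrr add0r divff ?gt_eqF//.
rewrite -mulrBr; congr (_ * _).
rewrite /A /antideriv !horner_sum -sumrB.
under eq_bigr => i _.
  rewrite !hornerZ !hornerXn expr1n expr0n/= mulr0 subr0 mulr1.
  over.
under [RHS]eq_bigr => i _.
  rewrite -sE horner_coef mulr_sumr.
  over.
rewrite exchange_big/=; apply: eq_bigr => j _.
rewrite -(quadrature_moment (leq_trans (ltn_ord j) su)) mulr_sumr.
by apply: eq_bigr => i _; rewrite mulrCA.
Qed.

(** For the Taylor remainder of the integrand, the 1 accounts for its integral and the sum for its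
    quadrature. *)
Definition quadrature_constant : R := 1 + \sum_(i < r) `|b i|.

Lemma quadrature_constant_ge0 : 0 <= quadrature_constant.
Proof. by rewrite addr_ge0// sumr_ge0. Qed.

(** The rule is exact on the Taylor polynomial of degree below [u], so only the remainder, at most K
    dt^u on the interval, contributes. The integrand enters through [K] alone, which is the
    uniformity that [quadrature_order] does not give directly. *)
Lemma quadrature_error (S : seq R) (F f : R -> R) (a dt K : R) : 0 < dt ->
  (forall i, 0 <= c i <= 1) ->
  {within `[a, a + dt], continuous F} ->
  (forall t, a < t < a + dt -> t \notin S -> is_derive t 1 F (f t)) ->
  {within `[a, a + dt], continuous f} ->
  (forall k t, (k < u)%N -> a < t < a + dt -> derivable (derive1n k f) t 1) ->
  (forall t, a < t < a + dt -> `|derive1n u f t| <= K) ->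
  `|F (a + dt) - F a - dt * \sum_(i < r) b i * f (a + c i * dt)|
    <= quadrature_constant * K * dt ^+ u.+1.
Proof.
move=> dt0 c01 cF dF cf df fK.
(* The centre is an interior point because derivatives are controlled on the open interval only. *)
pose m := a + dt / 2.
have aab : a < a + dt by rewrite ltrDl.
have am : a < m < a + dt by rewrite /m; apply/andP; split; lra.
pose p := taylor u f m.
have K0 : 0 <= K by apply: le_trans (fK m am).
have fp t : a < t < a + dt -> `|f t - p.[t]| <= K * dt ^+ u.
  move=> tab; apply: le_trans (taylor_remainder am df fK tab) _.
  rewrite ler_wpM2l// lerXn2r ?nnegrE ?(ltW dt0)//.
  by move: tab am => /andP[? ?] /andP[? ?]; rewrite ler_norml; apply/andP; split; lra.
have fpc t : a <= t <= a + dt -> `|f t - p.[t]| <= K * dt ^+ u.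
  apply: (@le_norm_closed _ (f - horner p)) => //.
  apply: within_continuousB => //.
  by apply: continuous_subspaceT; exact: continuous_horner.
have [P dP PE] := quadrature_exact a (size_taylor u f m) dt0.
have FP : `|(F (a + dt) - P.[a + dt]) - (F a - P.[a])| <= K * dt ^+ u * dt.
  rewrite -[X in _ * X](addrK a dt) [dt + a]addrC.
  apply: (@mean_value_le _ S (F - horner P) (fun t => f t - p.[t])).
  - exact: ltW.
  - apply: within_continuousB => //.
    by apply: continuous_subspaceT; exact: continuous_horner.
  - by move=> t tab tS; rewrite -dP; apply: is_deriveB; exact: dF.
  - by move=> t tab _; exact: fp.
set D := _ - _ - _.
have -> : D = ((F (a + dt) - P.[a + dt]) - (F a - P.[a])) +
    - (dt * \sum_(i < r) b i * (f (a + c i * dt) - p.[a + c i * dt])).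
  under [X in _ + - (dt * X)]eq_bigr do rewrite mulrBr.
  by rewrite sumrB mulrBr -PE /D; ring.
apply: (le_trans (ler_normD _ _)); rewrite normrN /quadrature_constant.
rewrite mulrDl mul1r mulrDl exprSr mulrA lerD// normrM gtr0_norm// mulrC.
rewrite [leRHS]mulrA ler_wpM2r ?(ltW dt0)// -mulrA mulr_suml.
apply: (le_trans (ler_norm_sum _ _ _)); apply: ler_sum => i _.
rewrite normrM ler_wpM2l// fpc//.
have /andP[c0 c1] := c01 i.
by rewrite lerDl mulr_ge0 ?(ltW dt0)//= lerD2l ler_piMl// ltW.
Qed.

End Quadrature.

(** * Piecewise C^1 curves and primitives along them *)

Lemma near_open_interval {R : realType} (a b t : R) : a < t < b ->
  \forall s \near t, a < s < b.
Proof.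
move=> /andP[at' tb]; near=> s; apply/andP; split; near: s.
  exact: lt_nbhsr.
exact: lt_nbhsl.
Unshelve. all: by end_near. Qed.

Section PiecewiseC1.
Context {R : realType} {E : normedModType R}.
Implicit Types (a b h t : R) (q z g : R -> E) (s : nat -> R).

Lemma derivable_continuous_at g t : derivable g t 1 -> {for t, continuous g}.
Proof. by move=> /derivable1_diffP; exact: differentiable_continuous. Qed.

Lemma derive1_eq_interval a b q g t : (forall x, a <= x <= b -> q x = g x) ->
  a < t < b -> derivable g t 1 ->
  derivable q t 1 /\ derive1 q t = derive1 g t.
Proof.
move=> qg atb dg; have gq : \forall x \near t, g x = q x.
  apply: filterS (near_open_interval atb) => x /andP[ax xb].
  by rewrite qg ?(ltW ax) ?(ltW xb).
split; first exact: near_eq_derivable dg.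
by rewrite !derive1E; apply: near_eq_derive; near do apply/esym.
Unshelve. all: by end_near. Qed.

Lemma within_bounded {V : normedModType R} (f : R -> V) a b :
  {within `[a, b], continuous f} ->
  exists C, forall t, a <= t <= b -> `|f t| <= C.
Proof.
move=> cf; have [M [_ MP]] : bounded_set (f @` `[a, b]).
  apply: compact_bounded; apply: continuous_compact => //.
  exact: segment_compact.
exists (M + 1) => t tab; apply: (MP (M + 1)); first by rewrite ltrDl.
by exists t => //=; rewrite in_itv.
Qed.

Lemma C1_on_within a b q : C1_on a b q -> {within `[a, b], continuous q}.
Proof.
move=> [g [dg _ qg]]; apply: (@subspace_eq_continuous _ _ _ g).
  by move=> t; rewrite inE/= in_itv/= => /qg.
by apply: continuous_subspaceT => t; exact: derivable_continuous_at.
Qed.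

Lemma nodes_sorted s k i : (forall j, (j < k)%N -> s j < s j.+1) ->
  (i <= k)%N -> s 0%N <= s i.
Proof.
move=> sk; elim: i => // i IH ik.
by rewrite (le_trans (IH (ltnW ik)))// ltW// sk.
Qed.

Lemma node_bounds s k j :
  (forall i, (i < k)%N -> s i < s i.+1) -> (j < k)%N ->
  s 0%N <= s j /\ s j.+1 <= s k.
Proof.
move=> sk jk; split; first exact: nodes_sorted (ltnW jk).
have Hs i : (j.+1 + i <= k)%N -> s j.+1 <= s (j.+1 + i)%N.
  elim: i => [|i IH]; rewrite ?addn0// addnS => ik.
  by rewrite (le_trans (IH (ltnW ik)))// ltW// sk.
by have := Hs (k - j.+1)%N; rewrite subnKC//; apply.
Qed.

Lemma node_interval s k t : s 0%N < t < s k ->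
  t \notin [seq s j | j <- iota 0 k.+1] ->
  exists2 j, (j < k)%N & s j < t < s j.+1.
Proof.
elim: k => [/andP[a b]|k IH /andP[s0t tsk]].
  by have := lt_trans a b; rewrite ltxx.
rewrite -[k.+2]addn1 iotaD map_cat mem_cat negb_or => /andP[tS _].
have [tk|] := ltP t (s k).
  have [|j jk sj] := IH _ tS; first by rewrite s0t tk.
  by exists j => //; exact: ltnW.
rewrite le_eqVlt => /predU1P[skt|kt]; last by exists k => //; rewrite kt tsk.
move: tS; rewrite -skt; case/negP; apply: map_f.
by rewrite mem_iota/= add0n ltnS.
Qed.

Lemma piecewise_C1_within h z :
  piecewise_C1 h z -> {within `[0, h], continuous z}.
Proof.
move=> [k [s [s0 <- sk Cz]]].
suff: forall i, (i <= k)%N -> {within `[0, s i], continuous z} by exact.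
elim=> [_|i IH ik]; first by rewrite s0 set_itv1; exact: continuous_subspace1.
have -> : `[0, s i.+1]%classic = `[0, s i] `|` `[s i, s i.+1].
  have si : 0 <= s i by rewrite -s0; exact: nodes_sorted (ltnW ik).
  apply/seteqP; split => t /=; rewrite !in_itv/=.
    by move=> /andP[-> ->]; case: (lerP t (s i)) => [|/ltW ->]; [left|right].
  move=> [/andP[-> /le_trans ->]//|/andP[/(le_trans si) -> ->//]].
  exact/ltW/sk.
apply: withinU_continuous; [exact: interval_closed..| |].
  exact/IH/ltnW.
exact/C1_on_within/Cz.
Qed.

Lemma piecewise_C1_derivable h z : piecewise_C1 h z ->
  exists (S : seq R) C, forall t, 0 < t < h -> t \notin S ->
    derivable z t 1 /\ `|derive1 z t| <= C.
Proof.
move=> [k [s [s0 <- sk Cz]]].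
have [C CP] : exists C, forall j t, (j < k)%N -> s j < t < s j.+1 ->
    derivable z t 1 /\ `|derive1 z t| <= C.
  elim: k sk Cz => [|k IH] sk Cz; first by exists 0.
  have [|j jk|C CP] := IH; [by move=> j jk; apply/sk/ltnW|by apply/Cz/ltnW|].
  have [g [dg cg zg]] := Cz k (ltnSn k).
  have [D DP] := within_bounded (continuous_subspaceT (A := `[s k, s k.+1]) cg).
  exists (Num.max C D) => j t; rewrite ltnS leq_eqVlt => /predU1P[->|jk] tj.
    have [dz ->] := derive1_eq_interval zg tj (dg t); split => //.
    by rewrite le_max DP ?orbT//; case/andP: tj => /ltW -> /ltW ->.
  by have [dz zC] := CP j t jk tj; split; rewrite // le_max zC.
exists [seq s j | j <- iota 0 k.+1], C => t tk tS.
have [|j jk] := @node_interval s k t _ tS; first by rewrite s0.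
exact: CP.
Qed.

(** The values of [f] at the nodes are arbitrary, as they are for an integrand containing [derive1]
    of a curve with kinks. Elsewhere [f] is continuous and is bounded by the functions [phi], so it
    is integrable, and its indefinite integral is a primitive off the nodes. *)
Lemma piecewise_integral (f : R -> R) k s : s 0%N = 0 ->
  (forall j, (j < k)%N -> s j < s j.+1) ->
  (forall j, (j < k)%N -> exists2 phi : R -> R,
     {within `[s j, s j.+1], continuous phi} &
     forall t, s j < t < s j.+1 -> f t = phi t) ->
  exists F : R -> R,
  [/\ {within `[0, s k], continuous F},
      forall t, 0 < t < s k -> t \notin [seq s j | j <- iota 0 k.+1] ->
        is_derive t 1 F (f t) &
      Rintegral lebesgue_measure `[0, s k] f = F (s k) - F 0].
Proof.
move=> s0 sk fk.
pose mu := @lebesgue_measure R.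
have s_ge0 i : (i <= k)%N -> 0 <= s i by rewrite -s0; exact: nodes_sorted.
have mfC : forall i, (i <= k)%N ->
    measurable_fun (`[0, s i]%classic : set (measurableTypeR R)) f /\
    exists C, forall t, 0 <= t <= s i -> `|f t| <= C.
  elim=> [_|i IH ik].
    rewrite s0 set_itv1; split; first exact: measurable_fun_set1.
    by exists `|f 0| => t; rewrite -eq_le => /eqP <-.
  have [mf [C fC]] := IH (ltnW ik); have [phi cphi fphi] := fk i ik.
  have [D phiD] := within_bounded cphi.
  split.
    have -> : `[0, s i.+1]%classic = `[0, s i] `|` `]s i, s i.+1].
      apply/seteqP; split => t /=; rewrite !in_itv/=.
        by move=> /andP[-> ->]; case: (lerP t (s i)) => _; [left|right].
      move=> [/andP[-> /le_trans ->]//|/andP[/ltW/(le_trans (s_ge0 _ (ltnW ik))) -> ->//]].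
      exact/ltW/sk.
    apply/measurable_funU => //; split => //.
    apply/measurable_realfun.measurable_fun_itv_bndo_bndcP.
    apply: (@eq_measurable_fun _ _ _ _ _ phi).
      by move=> t; rewrite inE/= in_itv/= => /fphi.
    apply: (@measurable_funS _ _ _ _ `[s i, s i.+1]%classic) => //.
      exact: subset_itv_oo_cc.
    exact: measurable_realfun.subspace_continuous_measurable_fun.
  exists (Num.max C (Num.max D `|f (s i.+1)|)) => t /andP[t0 ti].
  have [tsi|sit] := lerP t (s i); first by rewrite le_max fC ?t0.
  move: ti; rewrite le_eqVlt => /predU1P[->|ti].
    by rewrite !le_max lexx !orbT.
  by rewrite fphi ?sit// !le_max phiD ?orbT// (ltW sit) ltW.
have [mf [C fC]] := mfC k (leqnn k).
have intf : mu.-integrable `[0, s k] (EFin \o f).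
  apply: measurable_bounded_integrable => //.
    by rewrite /= lebesgue_measure_itv/=; case: ifP => _; rewrite ?ltry.
  exists C; split; first exact: num_real.
  by move=> M CM t; rewrite /= in_itv/= => tk; apply: le_trans (fC t tk) (ltW CM).
exists (fun x => parameterized_integral mu 0 x f); split.
- by apply: parameterized_integral_continuous => //; exact: s_ge0.
- move=> t tk tS; have /andP[t0 tk'] := tk.
  have [|j jk sj] := @node_interval s k t _ tS; first by rewrite s0.
  have [phi cphi fphi] := fk j jk.
  have ct : {for t, continuous f}.
    have cp : {for t, continuous phi}.
      apply: (within_continuous_continuous _ cphi); first exact: sk.
      by rewrite in_itv.
    rewrite /prop_for /continuous_at fphi//.
    apply: cvg_trans cp; apply: near_eq_cvg.
    by apply: filterS (near_open_interval sj) => x /fphi ->.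
  have [dF F'] := continuous_FTC1_closed tk' intf t0 ct.
  exact: DeriveDef dF (etrans (esym (derive1E _ _)) F').
- by rewrite /parameterized_integral set_itv1 Rintegral_set1 subr0.
Qed.

End PiecewiseC1.

(** A finite basis together with its dual basis of continuous forms. The estimates are proved over
    an abstract space with such data and then used for pairs of column vectors. *)
Record coordinates {R : realType} (E : normedModType R) (I : finType) := Coordinates {
  coordinate : I -> E -> R;
  basis_vector : I -> E;
  coordinate_linear : forall i (a : R) v w, coordinate i (a *: v + w) = a * coordinate i v + coordinate i w;
  coordinate_continuous : forall i, continuous (coordinate i);
  coordinate_basis : forall v, v = \sum_i coordinate i v *: basis_vector i;
  coordinate_basis_vector : forall i j, coordinate i (basis_vector j) = (i == j)%:R }.

(** * Differential calculus in coordinates *)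

Section Coordinates.
Context {R : realType} {E : normedModType R} {I : finType}.
Context (X : coordinates E I).
Implicit Types (v w : E) (z : R -> E) (t : R).

Lemma coordinateD i v w : coordinate X i (v + w) = coordinate X i v + coordinate X i w.
Proof. by rewrite -[v]scale1r coordinate_linear mul1r scale1r. Qed.

Lemma coordinate0 i : coordinate X i 0 = 0.
Proof. by apply: (addrI (coordinate X i 0)); rewrite -coordinateD !addr0. Qed.

Lemma coordinateZ i (a : R) v : coordinate X i (a *: v) = a * coordinate X i v.
Proof. by rewrite -[a *: v]addr0 coordinate_linear coordinate0 addr0. Qed.

Lemma coordinateB i v w : coordinate X i (v - w) = coordinate X i v - coordinate X i w.
Proof. by rewrite coordinateD -scaleN1r coordinateZ mulN1r. Qed.

Lemma coordinate_sum i (c : I -> R) :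
  coordinate X i (\sum_j c j *: basis_vector X j) = c i.
Proof.
have -> : coordinate X i (\sum_j c j *: basis_vector X j) =
    \sum_j c j * coordinate X i (basis_vector X j).
  elim: (index_enum I) => [|j s IH]; first by rewrite !big_nil coordinate0.
  by rewrite !big_cons coordinateD coordinateZ IH.
rewrite (bigD1 i)//= coordinate_basis_vector eqxx mulr1 big1 ?addr0// => j ji.
by rewrite coordinate_basis_vector eq_sym (negbTE ji) mulr0.
Qed.

Lemma coordinate_inj v w : (forall i, coordinate X i v = coordinate X i w) -> v = w.
Proof.
move=> vw; rewrite (coordinate_basis X v) (coordinate_basis X w).
by apply: eq_bigr => i _; rewrite vw.
Qed.

Lemma norm_le_coordinates v (a : I -> R) : (forall i, `|coordinate X i v| <= a i) ->
  `|v| <= \sum_i a i * `|basis_vector X i|.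
Proof.
move=> va; rewrite {1}(coordinate_basis X v).
apply: (le_trans (ler_norm_sum _ _ _)); apply: ler_sum => i _.
by rewrite normrZ ler_wpM2r.
Qed.

Lemma is_derive_coord i z t : derivable z t 1 ->
  is_derive t 1 (fun s => coordinate X i (z s)) (coordinate X i (derive1 z t)).
Proof.
move=> dz; have zt : h^-1 *: (z (h + t) - z t) @[h --> 0^'] --> derive1 z t.
  move: dz; rewrite /derivable/= => dz; rewrite /derive1.
  have -> : (fun h => h^-1 *: (z (h + t) - z t)) =
            (fun h : R => h^-1 *: (z (h *: (1 : R) + t) - z t)).
    by apply/funext => h; rewrite [h *: _]mulr1.
  exact: dz.
have := cvg_comp _ _ zt (@coordinate_continuous _ _ _ X i (derive1 z t)) => cz.
have {}cz : h^-1 *: (coordinate X i (z (h *: (1 : R) + t)) - coordinate X i (z t)) @[h --> 0^']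
    --> coordinate X i (derive1 z t).
  apply: cvg_trans cz; apply: near_eq_cvg; near=> h => /=.
  by rewrite coordinateZ coordinateB [h *: (1 : R)]mulr1.
by apply: DeriveDef; [apply/cvg_ex; eexists; exact: cz|exact: cvg_lim].
Unshelve. all: by end_near. Qed.

Lemma is_derive_sumT {V : normedModType R} (K : finType) (f : K -> R -> V) df t :
  (forall i, is_derive t 1 (f i) (df i)) ->
  is_derive t 1 (fun x => \sum_i f i x) (\sum_i df i).
Proof.
move=> fdf; elim: (index_enum K) => [|i s IH].
  have -> : (fun x : R => \sum_(j <- [::]) f j x) = cst 0.
    by apply/funext => x; rewrite big_nil.
  by rewrite big_nil; exact: is_derive_cst.
have -> : (fun x : R => \sum_(j <- i :: s) f j x) =
    f i + (fun x : R => \sum_(j <- s) f j x).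
  by apply/funext => x; rewrite big_cons.
by rewrite big_cons; apply: is_deriveD.
Qed.

Lemma is_derive_scalel {V : normedModType R} (a : R -> R) da (v : V) t :
  is_derive t 1 a da -> is_derive t 1 (fun x => a x *: v) (da *: v).
Proof.
move=> ada; have da1 : differentiable a t by apply/derivable1_diffP; case: ada.
have dav : differentiable (fun x => a x *: v) t by exact: differentiableZl.
apply: DeriveDef; first exact/derivable1_diffP.
by rewrite deriveE// diffZl//= -deriveE// derive_val.
Qed.

Lemma is_derive_coords z t dc :
  (forall i, is_derive t 1 (fun s => coordinate X i (z s)) (dc i)) ->
  is_derive t 1 z (\sum_i dc i *: basis_vector X i).
Proof.
move=> cz; have -> : z = fun s => \sum_i coordinate X i (z s) *: basis_vector X i.
  by apply/funext => s; exact: coordinate_basis.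
by apply: is_derive_sumT => i; exact: is_derive_scalel.
Qed.

Lemma derive_coords (psi : E -> R) x v : differentiable psi x ->
  'D_v psi x = \sum_i coordinate X i v * 'D_(basis_vector X i) psi x.
Proof.
move=> dpsi; rewrite deriveE// {1}(coordinate_basis X v) linear_sum.
by apply: eq_bigr => i _; rewrite linearZ/= deriveE.
Qed.

Lemma is_derive_comp_line (psi : E -> R) z dz t :
  differentiable psi (z t) -> is_derive t 1 z dz ->
  is_derive t 1 (psi \o z) ('D_dz psi (z t)).
Proof.
move=> dpsi [zt <-]; have dzt : differentiable z t by exact/derivable1_diffP.
apply: DeriveDef; first exact/derivable1_diffP/differentiable_comp.
by rewrite deriveE; [rewrite diff_comp//= -deriveE// -deriveE|exact: differentiable_comp].
Qed.

End Coordinates.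

Section PointwiseRules.
Context {R : realType}.
Implicit Types (f g : R -> R) (t : R).

Lemma is_derive1E {V : normedModType R} (f : R -> V) t d :
  is_derive t 1 f d -> derive1 f t = d.
Proof. by move=> [_ <-]; rewrite derive1E. Qed.

Lemma derivable_is_derive1 {V : normedModType R} (f : R -> V) t :
  derivable f t 1 -> is_derive t 1 f (derive1 f t).
Proof. by move=> df; split; rewrite // derive1E. Qed.

Lemma is_derive_addf f g t df dg : is_derive t 1 f df -> is_derive t 1 g dg ->
  is_derive t 1 (fun x => f x + g x) (df + dg).
Proof. exact: (@is_deriveD R R R f g t 1 df dg). Qed.

Lemma is_derive_subf f g t df dg : is_derive t 1 f df -> is_derive t 1 g dg ->
  is_derive t 1 (fun x => f x - g x) (df - dg).
Proof. exact: (@is_deriveB R R R f g t 1 df dg). Qed.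

Lemma is_derive_mulf f g t df dg : is_derive t 1 f df -> is_derive t 1 g dg ->
  is_derive t 1 (fun x => f x * g x) (f t * dg + g t * df).
Proof. exact: (@is_deriveM R R f g t 1 df dg). Qed.

Lemma is_derive_shiftf (m t : R) : is_derive t 1 (fun x : R => x - m) 1.
Proof.
rewrite -[1 in X in is_derive _ _ _ X]subr0; apply: is_derive_subf.
Qed.

End PointwiseRules.

(** * Derivatives bounded uniformly in a parameter *)

Section Tame.
Context {R : realType} {J : Type} {F : set_system (J * R)}.
Context {FF : Filter F}.
(* [F] is open in the time variable: an equality that holds along [F] can be
   differentiated. *)
Context (Fopen : forall A, F A -> F [set p | \forall s \near p.2, A (p.1, s)]).
Implicit Types (f g : J -> R -> R).

(** Along [F] the functions [f j] have [k] derivatives, bounded together with [f j] by constants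
    that do not depend on the parameter [j]. With the macro step as parameter this is regularity
    uniform in the step; with a trivial parameter it is regularity near one time. *)
Fixpoint tame k f : Prop :=
  (exists C : R, \forall p \near F, `|f p.1 p.2| <= C) /\
  match k with
  | 0 => True
  | k'.+1 => (\forall p \near F, derivable (f p.1) p.2 1) /\
             tame k' (fun j => derive1 (f j))
  end.

Lemma tameW k f : tame k.+1 f -> tame k f.
Proof. by elim: k f => [f []|k IH f [bf [df tf]]] //; split=> //; split=> //; exact: IH. Qed.

Lemma tame_eq k f g : (\forall p \near F, f p.1 p.2 = g p.1 p.2) ->
  tame k f -> tame k g.
Proof.
elim: k f g => [|k IH] f g fg [[C fC]].
  by move=> _; split=> //; exists C; near=> p; rewrite -(near fg p)//; near: p.
move=> [df tf]; split.
  by exists C; near=> p; rewrite -(near fg p)//; near: p.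
have fgo := Fopen fg; split.
  near=> p; apply: (near_eq_derivable (f := f p.1)); last by near: p.
  by near: p; apply: filterS fgo => p.
apply: IH tf; near=> p; rewrite !derive1E; apply: near_eq_derive.
by near: p; apply: filterS fgo => p.
Unshelve. all: by end_near. Qed.

Lemma tame_cst k (c : J -> R) : (exists C : R, \forall p \near F, `|c p.1| <= C) ->
  tame k (fun j _ => c j).
Proof.
elim: k c => // k IH c cC; split=> //; split.
  by apply: nearW => p; exact: derivable_cst.
have -> : (fun j : J => derive1 (fun=> c j)) = (fun j _ => 0 : R).
  by apply/funext => j; apply/funext => t; rewrite derive1_cst.
by apply: (IH (fun=> 0)); exists 0; apply: nearW => p; rewrite normr0.
Qed.

Lemma tameD k f g : tame k f -> tame k g -> tame k (fun j t => f j t + g j t).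
Proof.
elim: k f g => [|k IH] f g [[C fC] tf] [[D gD] tg]; split.
- exists (C + D); near=> p; apply: (le_trans (ler_normD _ _)).
  by apply: lerD; near: p.
- by [].
- exists (C + D); near=> p; apply: (le_trans (ler_normD _ _)).
  by apply: lerD; near: p.
case: tf tg => df tf [dg tg]; split.
  apply: filterS2 df dg => p dfp dgp.
  exact: (ex_derive (is_derive := is_derive_addf (derivableP dfp) (derivableP dgp))).
apply: tame_eq (IH _ _ tf tg).
apply: filterS2 df dg => p dfp dgp.
apply/esym/is_derive1E/is_derive_addf; exact: derivable_is_derive1.
Unshelve. all: by end_near. Qed.

Lemma tameM k f g : tame k f -> tame k g -> tame k (fun j t => f j t * g j t).
Proof.
elim: k f g => [|k IH] f g tf0 tg0; move: (tf0) (tg0) => [[C fC] tf] [[D gD] tg]; split.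
- exists (C * D); near=> p; rewrite normrM.
  by apply: ler_pM => //; near: p.
- by [].
- exists (C * D); near=> p; rewrite normrM.
  by apply: ler_pM => //; near: p.
case: tf tg => df tf [dg tg]; split.
  apply: filterS2 df dg => p dfp dgp.
  exact: (ex_derive (is_derive := is_derive_mulf (derivableP dfp) (derivableP dgp))).
apply: tame_eq (tameD (IH _ _ (tameW tf0) tg) (IH _ _ (tameW tg0) tf)).
apply: filterS2 df dg => p dfp dgp.
apply/esym; rewrite [X in _ + X]mulrC [X in _ + X]mulrC.
apply/is_derive1E/is_derive_mulf; exact: derivable_is_derive1.
Unshelve. all: by end_near. Qed.

Lemma tameZ k (a : R) f : tame k f -> tame k (fun j t => a * f j t).
Proof.
apply: tameM; apply: (tame_cst _ (c := fun=> a)).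
by exists `|a|; apply: nearW.
Qed.

Lemma tame_sum k (K : finType) (f : K -> J -> R -> R) : (forall i, tame k (f i)) ->
  tame k (fun j t => \sum_i f i j t).
Proof.
move=> tf; elim: (index_enum K) => [|i s IH].
  apply: (@tame_eq _ (fun _ _ => 0)).
    by apply: nearW => p; rewrite big_nil.
  by apply: (tame_cst _ (c := fun=> 0)); exists 0; apply: nearW => p; rewrite normr0.
by apply: tame_eq (tameD (tf i) IH); apply: nearW => p; rewrite big_cons.
Qed.

Lemma tame_exp k n f : tame k f -> tame k (fun j t => f j t ^+ n).
Proof.
move=> tf; elim: n => [|n IH].
  apply: (tame_cst _ (c := fun=> 1)).
  by exists 1; apply: nearW => p; rewrite /= normr1.
by apply: tame_eq (tameM tf IH); apply: nearW => p; rewrite /= exprS.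
Qed.

Lemma tame_shift k (m : J -> R) :
  (exists C : R, \forall p \near F, `|p.2 - m p.1| <= C) ->
  tame k (fun j t => t - m j).
Proof.
move=> bm; case: k => [//|k]; split=> //; split.
  by apply: nearW => p; case: (is_derive_shiftf (m p.1) p.2).
apply: (@tame_eq _ (fun _ _ => 1)).
  by apply: nearW => p; apply/esym/is_derive1E/is_derive_shiftf.
by apply: (tame_cst _ (c := fun=> 1)); exists 1; apply: nearW => p; rewrite normr1.
Qed.

(** The extra order makes the [n]-th derivative itself differentiable. *)
Lemma tame_derive1n_bound n f : tame n.+1 f ->
  exists C : R, \forall p \near F, forall m, (m <= n)%N ->
    derivable (derive1n m (f p.1)) (p.2 : R) 1 /\
    `|derive1n m (f p.1) (p.2 : R)| <= C.
Proof.
elim: n f => [|n IH] f [[C fC] [df tf]].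
  by exists C; apply: filterS2 fC df => p fC df m; rewrite leqn0 => /eqP ->.
have [D fD] := IH _ tf; exists (Num.max C D).
apply: filterS3 fC df fD => p fC df fD [_|m mn]; first by rewrite le_max fC.
by have [d b] := fD m mn; rewrite derive1Sn le_max b orbT.
Qed.

(** By the chain rule the derivative is a sum of products of a derivative of a coordinate of [z] and
    a partial derivative of [psi] along [z]. The latter is again a smooth function along [z], hence
    the induction on [k] for all [psi] at once. Convergence of [z] to a point of [Q] supplies the
    bounds of order 0. *)
Lemma tame_smooth_comp {E : normedModType R} {I : finType} (X : coordinates E I)
    (Q : set E) (psi : E -> R) (x0 : E) (z : J -> R -> E) k :
  open Q -> Q x0 -> smooth_on Q psi ->
  (fun p => z p.1 p.2) @ F --> x0 ->
  (forall i, tame k (fun j t => coordinate X i (z j t))) ->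
  tame k (fun j t => psi (z j t)).
Proof.
move=> oQ Qx0 + zx0.
have zQ : \forall p \near F, Q (z p.1 p.2).
  by apply: zx0; exact: open_nbhs_nbhs.
have bnd phi : Ck_on 0 Q phi -> exists C : R, \forall p \near F, `|phi (z p.1 p.2)| <= C.
  move=> cphi; exists (`|phi x0| + 1).
  have pz : phi (z p.1 p.2) @[p --> F] --> phi x0 by apply: cvg_comp zx0 _; exact: cphi.
  by move/cvgr_norm_le: pz; apply; rewrite ltrDl.
elim: k psi => [|k IH] psi spsi tz; first by split => //; exact: bnd (spsi 0%N).
split; first exact: bnd (spsi 0%N).
have dpsi x : Q x -> differentiable psi x by have [+ _] := spsi 1%N; exact.
have dz : \forall p \near F,
    is_derive (p.2 : R) 1 (psi \o z p.1)
      (\sum_i derive1 (fun t => coordinate X i (z p.1 t)) p.2 *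
         'D_(basis_vector X i) psi (z p.1 p.2)).
  have : \forall p \near F, forall i, derivable (fun t => coordinate X i (z p.1 t)) (p.2 : R) 1.
    by apply: filter_forall => i; have [_ []] := tz i.
  apply: filterS2 zQ => p Qp dcp.
  have dzp := is_derive_coords (X := X) (fun i => derivable_is_derive1 (dcp i)).
  have := is_derive_comp_line (dpsi _ Qp) dzp.
  rewrite (derive_coords X _ (dpsi _ Qp)).
  under eq_bigr => i _.
    rewrite -(is_derive1E dzp) -(is_derive1E (is_derive_coord X i (ex_derive (is_derive := dzp)))).
    over.
  exact.
split.
  by apply: filterS dz => p [].
apply: (@tame_eq _ (fun j t => \sum_i derive1 (fun s => coordinate X i (z j s)) t *
     'D_(basis_vector X i) psi (z j t))).
  by apply: filterS dz => p /is_derive1E ->.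
apply: tame_sum => i; apply: tameM; first by have [_ []] := tz i.
apply: (IH (fun x => 'D_(basis_vector X i) psi x)) => [n|j]; last exact/tameW/tz.
by have [_] := spsi n.+1; exact.
Qed.

End Tame.

(** * Local estimates for smooth functions on an open set *)

Section Lines.
Context {R : realType} {E : normedModType R}.
Implicit Types (x v w : E) (t : R).

Lemma is_derive_line (f : E -> R) x v d :
  is_derive (0 : R) 1 (fun h : R => f (h *: v + x)) d -> is_derive x v f d.
Proof.
move=> [df fd]; have fx : derivable f x v by exact/(derivable1P f x v).
split => //; rewrite -fd /derive.
set g1 := fun h => h^-1 *: _; set g2 := fun h => h^-1 *: _.
suff -> : g1 = g2 by [].
by apply/funext => h; rewrite /g1 /g2/= addr0 scale0r add0r [_%:A]mulr1.
Qed.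

Lemma is_derive_affine x v t : is_derive t 1 (fun s : R => x + s *: v) v.
Proof.
have := @is_deriveD R R E (cst x) _ t 1 0 _ (is_derive_cst _ _ _)
  (is_derive_scalel v (is_derive_id t (1 : R))).
by rewrite add0r scale1r.
Qed.

(** Continuity at 0 bounds a coordinate by 1 on a ball of radius [d]; scaling a vector to norm d / 2
    gives the constant 2 / d. The sum over the coordinates serves all of them. *)
Lemma coordinate_bound {I : finType} (X : coordinates E I) :
  exists2 C : R, 0 <= C & forall i v, `|coordinate X i v| <= C * `|v|.
Proof.
have H i : exists C : R, 0 <= C /\ forall v, `|coordinate X i v| <= C * `|v|.
  have c0 : coordinate X i v @[v --> (0 : E)] --> (0 : R).
    by have := @coordinate_continuous _ _ _ X i 0; rewrite /continuous_at coordinate0.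
  have /nbhs_ballP[d /= d0 dP] : \forall v \near (0 : E), `|coordinate X i v| <= 1.
    by move/cvgr_norm_le: c0; apply; rewrite normr0.
  exists (2 / d); split; first by rewrite divr_ge0// ltW.
  move=> v; have [->|v0] := eqVneq v 0; first by rewrite coordinate0 !normr0 mulr0.
  have nv0 : 0 < `|v| by rewrite normr_gt0.
  pose a := d / 2 / `|v|.
  have a0 : 0 < a by rewrite !divr_gt0.
  have : `|coordinate X i (a *: v)| <= 1.
    apply: dP; rewrite -ball_normE /= sub0r normrN normrZ gtr0_norm//.
    by rewrite divfK ?gt_eqF// ltr_pdivrMr// ltr_pMr// ltr1n.
  rewrite coordinateZ normrM gtr0_norm// -ler_pdivlMl// mulr1 => /le_trans; apply.
  rewrite le_eqVlt; apply/orP; left; apply/eqP; rewrite /a; field.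
  by rewrite normr_eq0 v0 gt_eqF.
have [C CP] := choice H.
exists (\sum_i C i) => [|i v]; first by apply: sumr_ge0 => i _; case: (CP i).
apply: le_trans (_ : C i * `|v| <= _); first by case: (CP i).
apply: ler_wpM2r => //; rewrite (bigD1 i)//= lerDl sumr_ge0// => j _.
by case: (CP j).
Qed.

Lemma ball_segment x0 (rho : R) x y s : ball x0 rho x -> ball x0 rho y ->
  0 <= s <= 1 -> ball x0 rho (x + s *: (y - x)).
Proof.
rewrite -ball_normE /= => xr yr /andP[s0 s1].
have -> : x0 - (x + s *: (y - x)) = (1 - s) *: (x0 - x) + s *: (x0 - y).
  rewrite scalerBl scale1r addrAC -addrA -scalerBr.
  by rewrite opprB (addrC (x0 - y)) addrA subrK opprD addrA -scalerN opprB.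
apply: (le_lt_trans (ler_normD _ _)); rewrite !normrZ !ger0_norm ?subr_ge0//.
have [->|s0'] := eqVneq s 0; first by rewrite subr0 mul1r mul0r addr0.
have -> : rho = (1 - s) * rho + s * rho by ring.
apply: ler_ltD; first by rewrite ler_wpM2l ?subr_ge0// ltW.
by rewrite ltr_pM2l// lt_neqAle eq_sym s0' s0.
Qed.

End Lines.

Section LocalEstimates.
Context {R : realType} {E : normedModType R} {I : finType} (X : coordinates E I).
Context (Q : set E) (oQ : open Q).
Implicit Types (psi : E -> R) (x y : E).

Lemma is_derive_segment psi x v (s : R) : differentiable psi (x + s *: v) ->
  is_derive s 1 (fun r : R => psi (x + r *: v)) ('D_v psi (x + s *: v)).
Proof.
by move=> dpsi; exact: (is_derive_comp_line (z := fun r : R => x + r *: v) dpsi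
  (is_derive_affine x v s)).
Qed.

Lemma near0_ball (x0 : E) (A : set E) : nbhs x0 A ->
  \forall rho \near (0 : R)^'+, ball x0 rho `<=` A.
Proof.
move=> /nbhs_ballP[d /= d0 dA]; near=> rho; apply: subset_trans dA.
by apply: le_ball; apply/ltW; near: rho; exact: nbhs_right_lt.
Unshelve. all: by end_near. Qed.

Lemma smooth_local_bound psi (x0 : E) : smooth_on Q psi -> Q x0 ->
  exists C : R, \forall rho \near (0 : R)^'+, forall x, ball x0 rho x -> `|psi x| <= C.
Proof.
move=> spsi Qx0; exists (`|psi x0| + 1).
have cpsi : psi x @[x --> x0] --> psi x0 by exact: (spsi 0%N).
have : \forall x \near x0, `|psi x| <= `|psi x0| + 1.
  by move/cvgr_norm_le: cpsi; apply; rewrite ltrDl.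
by move=> /near0_ball; apply: filterS => rho H x /H.
Qed.

Lemma smooth_derive psi w : smooth_on Q psi -> smooth_on Q (fun x => 'D_w psi x).
Proof. by move=> spsi n; have [_] := spsi n.+1; exact. Qed.

Lemma smooth_differentiable psi x : smooth_on Q psi -> Q x -> differentiable psi x.
Proof. by move=> spsi; have [+ _] := spsi 1%N; exact. Qed.

(** Mean value inequality along the segment from [x] to [y], which stays in the ball by convexity,
    with the partial derivatives bounded near [x0]. *)
Lemma smooth_local_lipschitz psi (x0 : E) : smooth_on Q psi -> Q x0 ->
  exists C : R, 0 <= C /\ \forall rho \near (0 : R)^'+,
    forall x y, ball x0 rho x -> ball x0 rho y -> `|psi y - psi x| <= C * `|y - x|.
Proof.
move=> spsi Qx0.
have /choice[D DP] i := smooth_local_bound (smooth_derive (basis_vector X i) spsi) Qx0.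
have [M M0 MP] := coordinate_bound X.
exists (\sum_i M * `|D i|); split; first by apply: sumr_ge0 => i _; rewrite mulr_ge0.
have DP' : \forall rho \near (0 : R)^'+, forall i, forall x, ball x0 rho x ->
  `|'D_(basis_vector X i) psi x| <= D i by apply: filter_forall => i; exact: DP.
have Qb := near0_ball (open_nbhs_nbhs (conj oQ Qx0)).
apply: filterS2 DP' Qb => rho DP' Qb x y xb yb.
have seg (s : R) : 0 <= s <= 1 -> ball x0 rho (x + s *: (y - x)).
  exact: ball_segment.
have dl (s : R) : 0 <= s <= 1 -> is_derive s 1 (fun r : R => psi (x + r *: (y - x)))
    ('D_(y - x) psi (x + s *: (y - x))).
  by move=> s01; apply/is_derive_segment/smooth_differentiable/Qb/seg.
have := @mean_value_le _ [::] (fun r : R => psi (x + r *: (y - x)))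
  (fun s => 'D_(y - x) psi (x + s *: (y - x)))
  ((\sum_i M * `|D i|) * `|y - x|) 0 1 ler01.
rewrite scale1r scale0r addr0 [x + _]addrC subrK subr0 mulr1; apply.
- apply: derivable_within_continuous => s; rewrite in_itv/= => s01.
  by case: (dl s s01).
- by move=> s /andP[/ltW s0 /ltW s1] _; apply: dl; rewrite s0.
move=> s /andP[s0 s1] _.
have s01 : 0 <= s <= 1 by rewrite (ltW s0) ltW.
rewrite (derive_coords X); last exact/smooth_differentiable/Qb/seg.
apply: (le_trans (ler_norm_sum _ _ _)); rewrite mulr_suml.
apply: ler_sum => i _; rewrite normrM mulrAC; apply: ler_pM => //.
by apply: (le_trans (DP' i _ (seg s s01))); exact: ler_norm.
Qed.

(** The segment argument again, after subtraction of the linear part: the partial derivatives are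
    locally Lipschitz, which supplies the second factor |y - x|. *)
Lemma smooth_local_taylor psi (x0 : E) : smooth_on Q psi -> Q x0 ->
  exists C : R, 0 <= C /\ \forall rho \near (0 : R)^'+,
    forall x y, ball x0 rho x -> ball x0 rho y ->
      `|psi y - psi x - 'D_(y - x) psi x| <= C * `|y - x| ^+ 2.
Proof.
move=> spsi Qx0.
have /choice[D DP] i := smooth_local_lipschitz (smooth_derive (basis_vector X i) spsi) Qx0.
have [M M0 MP] := coordinate_bound X.
exists (\sum_i M * D i); split.
  by apply: sumr_ge0 => i _; rewrite mulr_ge0//; case: (DP i).
have DP' : \forall rho \near (0 : R)^'+, forall i x y, ball x0 rho x -> ball x0 rho y ->
    `|'D_(basis_vector X i) psi y - 'D_(basis_vector X i) psi x| <= D i * `|y - x|.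
  by apply: filter_forall => i; case: (DP i).
have Qb := near0_ball (open_nbhs_nbhs (conj oQ Qx0)).
apply: filterS2 DP' Qb => rho DP' Qb x y xb yb.
have seg (s : R) : 0 <= s <= 1 -> ball x0 rho (x + s *: (y - x)).
  exact: ball_segment.
pose d0 := 'D_(y - x) psi x.
have dl (s : R) : 0 <= s <= 1 -> is_derive s 1
    (fun r : R => psi (x + r *: (y - x)) - r * d0)
    ('D_(y - x) psi (x + s *: (y - x)) - d0).
  move=> s01; apply: is_derive_subf.
    by apply/is_derive_segment/smooth_differentiable/Qb/seg.
  by have := is_derive_scalel d0 (is_derive_id s (1 : R)); rewrite scale1r.
have := @mean_value_le _ [::] (fun r : R => psi (x + r *: (y - x)) - r * d0)
  (fun s => 'D_(y - x) psi (x + s *: (y - x)) - d0)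
  ((\sum_i M * D i) * `|y - x| ^+ 2) 0 1 ler01.
rewrite scale1r scale0r addr0 [x + _]addrC subrK !subr0 mulr1 mul1r mul0r subr0.
rewrite addrAC; apply.
- apply: derivable_within_continuous => s; rewrite in_itv/= => s01.
  by case: (dl s s01).
- by move=> s /andP[/ltW s0 /ltW s1] _; apply: dl; rewrite s0.
move=> s /andP[s0 s1] _.
have s01 : 0 <= s <= 1 by rewrite (ltW s0) ltW.
rewrite /d0 !(derive_coords X); last exact/smooth_differentiable/Qb/seg.
  rewrite -sumrB; apply: (le_trans (ler_norm_sum _ _ _)); rewrite mulr_suml.
  apply: ler_sum => i _; rewrite -mulrBr normrM expr2 mulrACA.
  apply: ler_pM => //; apply: (le_trans (DP' i _ _ xb (seg s s01))).
  rewrite addrAC subrr add0r normrZ gtr0_norm// ler_wpM2l//; first by case: (DP i).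
  by rewrite ler_piMl// ltW.
exact/smooth_differentiable/Qb.
Qed.

End LocalEstimates.

Lemma cvg_sumT {R : realType} {T : Type} (F : set_system T) {FF : Filter F}
    (K : finType) (f : K -> T -> R) (l : K -> R) :
  (forall i, f i x @[x --> F] --> l i) ->
  \sum_i f i x @[x --> F] --> \sum_i l i.
Proof.
move=> fl; elim: (index_enum K) => [|i s IH].
  under eq_fun do rewrite big_nil.
  by rewrite big_nil; exact: cvg_cst.
under eq_fun do rewrite big_cons.
by rewrite big_cons; exact: cvgD.
Qed.

(** * Lagrangians of the form kinetic minus potential energy *)

Section NaturalLagrangian.
Context {R : realType} {E : normedModType R} {I : finType} (X : coordinates E I).
Context (B : E -> E -> R).
Context (Bl : forall (a : R) v v' w, B (a *: v + v') w = a * B v w + B v' w).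
Context (Br : forall (a : R) v w w', B v (a *: w + w') = a * B v w + B v w').
Context (U : E -> R) (Q : set E) (oQ : open Q) (sU : smooth_on Q U).

Definition natural_lagrangian (z : E * E) : R := 2^-1 * B z.2 z.2 - U z.1.
(** The velocity derivative of the Lagrangian at [v], paired with [w]; [B] is not supposed
    symmetric, hence the average. *)
Definition momentum (v w : E) : R := 2^-1 * (B v w + B w v).

Local Notation L := natural_lagrangian.
Local Notation co := (coordinate X).
Local Notation e_ := (basis_vector X).

Lemma bilin0l w : B 0 w = 0.
Proof.
have := Bl 1 0 0 w; rewrite scaler0 addr0 mul1r => /eqP.
by rewrite -subr_eq0 opprD addrA subrr sub0r oppr_eq0 => /eqP.
Qed.

Lemma bilin0r v : B v 0 = 0.
Proof.
have := Br 1 v 0 0; rewrite scaler0 addr0 mul1r => /eqP.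
by rewrite -subr_eq0 opprD addrA subrr sub0r oppr_eq0 => /eqP.
Qed.

Lemma bilinZl a v w : B (a *: v) w = a * B v w.
Proof. by have := Bl a v 0 w; rewrite addr0 bilin0l addr0. Qed.

Lemma bilinZr a v w : B v (a *: w) = a * B v w.
Proof. by have := Br a v w 0; rewrite addr0 bilin0r addr0. Qed.

Lemma bilinDl v v' w : B (v + v') w = B v w + B v' w.
Proof. by have := Bl 1 v v' w; rewrite scale1r mul1r. Qed.

Lemma bilinDr v w w' : B v (w + w') = B v w + B v w'.
Proof. by have := Br 1 v w w'; rewrite scale1r mul1r. Qed.

Lemma bilin_suml (K : finType) (c : K -> R) (f : K -> E) w :
  B (\sum_i c i *: f i) w = \sum_i c i * B (f i) w.
Proof.
elim: (index_enum K) => [|i s IH]; first by rewrite !big_nil bilin0l.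
by rewrite !big_cons bilinDl bilinZl IH.
Qed.

Lemma bilin_sumr (K : finType) (c : K -> R) (f : K -> E) v :
  B v (\sum_i c i *: f i) = \sum_i c i * B v (f i).
Proof.
elim: (index_enum K) => [|i s IH]; first by rewrite !big_nil bilin0r.
by rewrite !big_cons bilinDr bilinZr IH.
Qed.

Lemma bilin_coords v w : B v w = \sum_i \sum_j co i v * co j w * B (e_ i) (e_ j).
Proof.
rewrite {1}(coordinate_basis X v) bilin_suml; apply: eq_bigr => i _.
rewrite {1}(coordinate_basis X w) bilin_sumr mulr_sumr.
by apply: eq_bigr => j _; rewrite mulrA.
Qed.

Lemma momentum_sumr (K : finType) (c : K -> R) (f : K -> E) v :
  momentum v (\sum_i c i *: f i) = \sum_i c i * momentum v (f i).
Proof.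
rewrite /momentum bilin_suml bilin_sumr -big_split mulr_sumr /=.
by apply: eq_bigr => i _; ring.
Qed.

Lemma momentum_suml (K : finType) (c : K -> R) (f : K -> E) w :
  momentum (\sum_i c i *: f i) w = \sum_i c i * momentum (f i) w.
Proof.
rewrite /momentum bilin_suml bilin_sumr -big_split mulr_sumr /=.
by apply: eq_bigr => i _; ring.
Qed.

Lemma continuous_momentum w : continuous (momentum ^~ w).
Proof.
move=> v; have -> : momentum ^~ w = fun v => \sum_i co i v * momentum (e_ i) w.
  by apply/funext => u; rewrite {1}(coordinate_basis X u) momentum_suml.
apply: cvg_sumT => i; apply: cvgM; last exact: cvg_cst.
exact: coordinate_continuous.
Qed.

Lemma bilin_square_bound : exists2 C : R, 0 <= C & forall v, `|B v v| <= C * `|v| ^+ 2.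
Proof.
have [M M0 MP] := coordinate_bound X.
exists (\sum_i \sum_j M * M * `|B (e_ i) (e_ j)|) => [|v].
  by do 2 apply: sumr_ge0 => ? _; rewrite !mulr_ge0.
rewrite bilin_coords mulr_suml; apply: (le_trans (ler_norm_sum _ _ _)).
apply: ler_sum => i _; rewrite mulr_suml; apply: (le_trans (ler_norm_sum _ _ _)).
apply: ler_sum => j _; rewrite !normrM.
have -> : M * M * `|B (e_ i) (e_ j)| * `|v| ^+ 2 =
  (M * `|v|) * (M * `|v|) * `|B (e_ i) (e_ j)| by ring.
by rewrite ler_wpM2r// ler_pM.
Qed.

Lemma natural_lagrangian_continuous x v : Q x -> {for (x, v), continuous L}.
Proof.
move=> Qx; rewrite /prop_for /continuous_at /natural_lagrangian /=.
apply: cvgB; last first.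
  apply: (cvg_comp (fun z : E * E => z.1) U); first exact: cvg_fst.
  exact: (sU 0%N).
apply: cvgM; first exact: cvg_cst.
have -> : (fun z : E * E => B z.2 z.2) =
   fun z => \sum_i \sum_j co i z.2 * co j z.2 * B (e_ i) (e_ j).
  by apply/funext => z; rewrite bilin_coords.
rewrite bilin_coords.
have cc i : co i z.2 @[z --> (x, v)] --> co i v.
  apply: (cvg_comp (fun z : E * E => z.2) (co i)); first exact: cvg_snd.
  exact: coordinate_continuous.
do 2 (apply: cvg_sumT => ?).
by apply: cvgM; [apply: cvgM; exact: cc|exact: cvg_cst].
Qed.

Lemma derive_velocity w x v : is_derive (x, v) (0, w) L (momentum v w).
Proof.
apply: is_derive_line.
have -> : (fun h : R => L (h *: (0, w) + (x, v))) =
  (fun h => (2^-1 * B v v - U x) + h * (momentum v w + h * (2^-1 * B w w))).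
  apply/funext => h; rewrite /natural_lagrangian /momentum /= scaler0 add0r.
  by rewrite !(bilinDl, bilinDr, bilinZl, bilinZr); ring.
have H1 := is_derive_addf (is_derive_cst (momentum v w) (0 : R) (1 : R))
  (is_derive_mulf (is_derive_id (0 : R) (1 : R)) (is_derive_cst (2^-1 * B w w) (0 : R) (1 : R))).
have := is_derive_addf (is_derive_cst (2^-1 * B v v - U x) (0 : R) (1 : R))
  (is_derive_mulf (is_derive_id (0 : R) (1 : R)) H1).
by congr (is_derive _ _ _ _); rewrite /cst; ring.
Qed.

Lemma derive_position w x v : Q x -> is_derive (x, v) (w, 0) L (- 'D_w U x).
Proof.
move=> Qx; apply: is_derive_line.
have -> : (fun h : R => L (h *: (w, 0) + (x, v))) =
  (fun h => 2^-1 * B v v - U (x + h *: w)).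
  apply/funext => h; rewrite /natural_lagrangian /= scaler0 add0r.
  by rewrite [x + _]addrC.
have dU : differentiable U (x + 0 *: w).
  by rewrite scale0r addr0; exact: (smooth_differentiable sU).
have := is_derive_subf (is_derive_cst (2^-1 * B v v) (0 : R) (1 : R))
  (is_derive_segment dU).
by rewrite sub0r scale0r addr0.
Qed.

Lemma EL_momentum h q : EL_solution Q L h q -> forall t, 0 < t < h -> forall w,
  is_derive t 1 (fun s => momentum (derive1 q s) w) (- 'D_w U (q t)).
Proof.
move=> [_ qQ EL] t th w; have := EL t th w.
have -> : (fun s : R => 'D_(0, w) L (q s, derive1 q s)) =
          (fun s => momentum (derive1 q s) w).
  by apply/funext => s; exact: (derive_val (is_derive := derive_velocity w (q s) (derive1 q s))).
rewrite (derive_val (is_derive := derive_position w (derive1 q t) (qQ t _)))//.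
by case/andP: th => /ltW -> /ltW ->.
Qed.

(** Between two nodes the curve may be replaced by its C^1 extension, along which the Lagrangian is
    continuous up to the nodes. The action thus becomes an increment of a primitive, open to the
    mean value inequality. *)
Lemma action_primitive (h : R) (z : R -> E) : piecewise_C1 h z -> (forall t, 0 <= t <= h -> Q (z t)) ->
  exists (F : R -> R) (S : seq R),
  [/\ {within `[0, h], continuous F},
      forall t, 0 < t < h -> t \notin S -> derivable z t 1 /\
        is_derive t 1 F (L (z t, derive1 z t)) &
      action L h z = F h - F 0].
Proof.
move=> pz zQ; have [S [C dz]] := piecewise_C1_derivable pz.
case: pz => k [s [s0 skh sk Cz]]; subst h.
have Lz j : (j < k)%N -> exists2 phi : R -> R,
    {within `[s j, s j.+1], continuous phi} &
    forall t, s j < t < s j.+1 -> L (z t, derive1 z t) = phi t.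
  move=> jk; have [g [dg cg zg]] := Cz j jk.
  exists (fun t => L (g t, derive1 g t)).
    apply: continuous_in_subspaceT => t; rewrite inE/= in_itv/= => /andP[jt tj].
    have Qgt : Q (g t).
      rewrite -zg ?jt ?tj//; apply: zQ; rewrite -{1}s0.
      have [sj0 sjk] := node_bounds sk jk.
      by rewrite (le_trans sj0 jt) (le_trans tj sjk).
    apply: (@cvg_comp _ _ _ (fun s => (g s, derive1 g s)) L (nbhs t)
        (nbhs (g t, derive1 g t))); last exact: natural_lagrangian_continuous.
    apply: cvg_pair; last exact: cg.
    exact: (derivable_continuous_at (dg t)).
  move=> t tj; have [_ ->] := derive1_eq_interval zg tj (dg t).
  by rewrite zg//; case/andP: tj => /ltW -> /ltW ->.
have [F [cF dF aF]] := piecewise_integral s0 sk Lz.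
exists F, ([seq s j | j <- iota 0 k.+1] ++ S); split => // t tk.
rewrite mem_cat negb_or => /andP[tS1 tS]; split; last exact: dF.
by have [] := dz t tk tS.
Qed.

Lemma C1_on_piecewise (h : R) (q : R -> E) : 0 < h -> C1_on 0 h q -> piecewise_C1 h q.
Proof.
by move=> h0 Cq; exists 1%N, (fun j => j%:R * h); split; rewrite ?mul0r ?mul1r// => -[]//; rewrite mul0r mul1r.
Qed.

Lemma EL_admissible h q : 0 < h -> EL_solution Q L h q ->
  admissible_curve Q h (q 0) (q h) q.
Proof. by move=> h0 [Cq qQ _]; split => //; exact: C1_on_piecewise. Qed.

(* The first variation telescopes: p . (z - q) is a primitive of the linear part
   of L(z, z') - L(q, q'), and it vanishes at both ends. *)
Lemma action_gap h q z (S : seq R) M : 0 < h -> EL_solution Q L h q ->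
  admissible_curve Q h (q 0) (q h) z ->
  (forall t, 0 < t < h -> t \notin S -> derivable z t 1 ->
    `|2^-1 * B (derive1 z t - derive1 q t) (derive1 z t - derive1 q t)
      - (U (z t) - U (q t) - 'D_(z t - q t) U (q t))| <= M) ->
  `|action L h z - action L h q| <= M * h.
Proof.
move=> h0 ELq [pz zQ z0 zh] zM.
have [pq qQ _ _] := EL_admissible h0 ELq.
have [Fz [Sz [cFz dFz ->]]] := action_primitive pz zQ.
have [Fq [Sq [cFq dFq ->]]] := action_primitive pq qQ.
have pE := EL_momentum ELq.
have [[g [dg cg qg]] _ _] := ELq.
have inn t : 0 < t < h -> 0 <= t <= h by move=> /andP[/ltW -> /ltW ->].
have gz0 : z 0 - g 0 = 0 by rewrite z0 -qg ?subrr// lexx ltW.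
have gzh : z h - g h = 0 by rewrite zh -qg ?subrr// lexx ltW.
(* The C^1 extension [g] replaces [q] so that [P] is continuous up to 0 and [h], where [derive1 q]
   would depend on values of [q] outside the interval. *)
pose P t := \sum_i co i (z t - g t) * momentum (derive1 g t) (e_ i).
have Pz t : z t - g t = 0 -> P t = 0.
  by move=> d0; rewrite /P d0; apply: big1 => i _; rewrite coordinate0 mul0r.
pose f t := 2^-1 * B (derive1 z t - derive1 q t) (derive1 z t - derive1 q t)
      - (U (z t) - U (q t) - 'D_(z t - q t) U (q t)).
have -> : Fz h - Fz 0 - (Fq h - Fq 0) =
   (Fz h - Fq h - P h) - (Fz 0 - Fq 0 - P 0) by rewrite !Pz//; ring.
rewrite -[X in _ * X]subr0.
apply: (@mean_value_le _ (Sz ++ Sq ++ S) (fun t => Fz t - Fq t - P t) f).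
- exact: ltW.
- apply: within_continuousB; first exact: within_continuousB.
  move=> t; apply: cvg_sumT => i; apply: cvgM.
    apply: (within_continuous_comp _ (fun t => z t - g t) (co i)).
      by move=> ? _; exact: coordinate_continuous.
    apply: within_continuousB; first exact: piecewise_C1_within.
    by apply: continuous_subspaceT => s; exact: derivable_continuous_at.
  apply: (within_continuous_comp _ (derive1 g) (momentum ^~ (e_ i))).
    by move=> ? _; exact: continuous_momentum.
  exact: continuous_subspaceT.
- move=> t th; rewrite !mem_cat !negb_or => /and3P[tz tq tS].
  have [dz dFzt] := dFz t th tz; have [dq dFqt] := dFq t th tq.
  have [_ dqg] := derive1_eq_interval qg th (dg t).
  have dd : is_derive t 1 (fun s => z s - g s) (derive1 z t - derive1 g t).
    apply: (@is_deriveB R R E z g); exact: derivable_is_derive1.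
  have dP : is_derive t 1 P
     (momentum (derive1 q t) (derive1 z t - derive1 q t) - 'D_(z t - q t) U (q t)).
    have -> : momentum (derive1 q t) (derive1 z t - derive1 q t) - 'D_(z t - q t) U (q t) =
      \sum_i (co i (z t - g t) * - 'D_(e_ i) U (q t) +
              momentum (derive1 g t) (e_ i) * co i (derive1 z t - derive1 g t)).
      rewrite big_split/= addrC; congr (_ + _).
        rewrite dqg {1}(coordinate_basis X (derive1 z t - derive1 g t)) momentum_sumr.
        by apply: eq_bigr => i _; rewrite mulrC.
      rewrite (derive_coords X); last exact/(smooth_differentiable sU)/qQ/inn.
      by rewrite qg ?inn// -sumrN; apply: eq_bigr => i _; rewrite mulrN.
    apply: is_derive_sumT => i; apply: is_derive_mulf.
      rewrite -(is_derive1E dd); apply: is_derive_coord.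
      exact: (ex_derive (is_derive := dd)).
    apply: near_eq_is_derive (pE t th (e_ i)).
    apply: filterS (near_open_interval th) => s sh.
    by have [_ ->] := derive1_eq_interval qg sh (dg s).
  have := is_derive_subf (is_derive_subf dFzt dFqt) dP.
  congr (is_derive _ _ _ _); rewrite /f /natural_lagrangian /momentum /=.
  set d := derive1 z t - derive1 q t.
  have -> : derive1 z t = derive1 q t + d by rewrite addrC subrK.
  by rewrite !(bilinDl, bilinDr); ring.
- move=> t th; rewrite !mem_cat !negb_or => /and3P[tz tq tS].
  by apply: zM => //; have [] := dFz t th tz.
Qed.

End NaturalLagrangian.

(** * Solutions of the Euler-Lagrange equations are critical curves *)

Lemma is_derive0_quadratic {R : realType} (f : R -> R) (C : R) :
  (\forall e \near (0 : R), `|f e - f 0| <= C * e ^+ 2) -> is_derive (0 : R) 1 f 0.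
Proof.
move=> fC; have f0 : h^-1 *: (f (h *: (1 : R) + 0) - f 0) @[h --> 0^'] --> (0 : R).
  apply/cvgrPdist_le => eps eps0.
  have C0 : 0 < `|C| + 1 by rewrite ltr_wpDl.
  near=> h.
  have h0 : h != 0 by near: h; exact: nbhs_dnbhs_neq.
  rewrite sub0r normrN [h *: 1]mulr1 addr0 normrM normfV ler_pdivrMl ?normr_gt0//.
  have fh : `|f h - f 0| <= C * h ^+ 2 by near: h; exact: nbhs_dnbhs.
  apply: (le_trans fh); rewrite -real_normK ?num_real// expr2 mulrA mulrC.
  rewrite ler_wpM2l//; apply: (@le_trans _ _ ((`|C| + 1) * `|h|)).
    by rewrite ler_wpM2r// (le_trans (ler_norm _))// lerDl.
  rewrite -ler_pdivlMl// mulrC; near: h.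
  apply: dnbhs0_le; exact: divr_gt0.
by apply: DeriveDef; [apply/cvg_ex; exists 0|exact: cvg_lim].
Unshelve. all: by end_near. Qed.

Section CriticalCurves.
Context {R : realType} {E : normedModType R} {I : finType} (X : coordinates E I).
Context (B : E -> E -> R).
Context (Bl : forall (a : R) v v' w, B (a *: v + v') w = a * B v w + B v' w).
Context (Br : forall (a : R) v w w', B v (a *: w + w') = a * B v w + B v w').
Context (U : E -> R) (Q : set E) (oQ : open Q) (sU : smooth_on Q U).
Local Notation L := (natural_lagrangian B U).
Local Notation co := (coordinate X).

Lemma piecewise_C1_perturb (h : R) (q d : R -> E) (e : R) : C1_on 0 h q ->
  piecewise_C1 h d -> piecewise_C1 h (fun t => q t + e *: d t).
Proof.
move=> [g [dg cg qg]] [k [s [s0 skh sk Cd]]]; exists k, s; split=> // j jk.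
have [f [df cf dfE]] := Cd j jk.
have Dg (t : R) : is_derive t 1 (fun x => g x + e *: f x) (derive1 g t + e *: derive1 f t).
  apply: (@is_deriveD R R E g (fun x => e *: f x)).
    exact: derivable_is_derive1.
  by apply: (@is_deriveZ R R E f); exact: derivable_is_derive1.
have [sj0 sjk] := node_bounds sk jk.
exists (fun t => g t + e *: f t); split.
- by move=> t; case: (Dg t).
- have -> : derive1 (fun t => g t + e *: f t) = fun t => derive1 g t + e *: derive1 f t.
    by apply/funext => t; exact: is_derive1E.
  move=> t; apply: cvgD; first exact: cg.
  by apply: cvgZ; [exact: cvg_cst|exact: cf].
- move=> t /andP[jt tj]; rewrite dfE ?jt// qg//.
  by rewrite -{1}s0 -skh (le_trans sj0 jt) (le_trans tj sjk).
Qed.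

(** By compactness of [0, h] the local Taylor estimates around the points of the curve hold with one
    constant. The same [M] says how small [e] must be for the perturbed curve to remain where they
    apply. *)
Lemma perturbation_quadratic (h D : R) (q d : R -> E) :
  {within `[0, h], continuous q} -> (forall t, 0 <= t <= h -> Q (q t)) ->
  (forall t, 0 <= t <= h -> `|d t| <= D) ->
  exists2 M : R, 0 < M & forall e, `|e| * M < 1 -> forall t, 0 <= t <= h ->
    Q (q t + e *: d t) /\
    `|U (q t + e *: d t) - U (q t) - 'D_(e *: d t) U (q t)| <= M * e ^+ 2.
Proof.
move=> cq qQ dD.
have cov := (near_covering_withinP _).2 ((compact_near_coveringP _).1 (@segment_compact R 0 h)).
pose P (M t : R) := forall e : R, `|e| * M < 1 -> Q (q t + e *: d t) /\
    `|U (q t + e *: d t) - U (q t) - 'D_(e *: d t) U (q t)| <= M * e ^+ 2.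
have PM : \forall M \near +oo, `[0, h]%classic `<=` P M.
  apply: (cov R +oo P) => t0 /=; rewrite in_itv/= => t0h.
  have Qt0 := qQ t0 t0h.
  have [C [C0 HC]] := smooth_local_taylor X oQ sU Qt0.
  have HQ := near0_ball (open_nbhs_nbhs (conj oQ Qt0)).
  have [rho [HQr [HCr rho0]]] := filter_ex (filterI HQ (filterI HC (nbhs_right_gt (0 : R)))).
  have D0 : 0 <= D by apply: le_trans (dD t0 t0h).
  have qt0 : \forall t \near within `[0, h] (nbhs t0), `|q t0 - q t| < rho / 2.
    have /(_ t0) := (subspace_continuousP _ _).1 cq.
    rewrite /= in_itv/= => /(_ t0h) /cvgrPdist_lt; apply; exact: divr_gt0.
  (* The first condition on [M] turns |e| M < 1 into |e d(t)| < rho / 2, which keeps the perturbed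
     point in the ball of radius [rho]; the second absorbs the Taylor constant times the square of
     |d(t)|. *)
  exists ([set t | `[0, h]%classic t -> `|q t0 - q t| < rho / 2],
    [set M : R | 2 * (D + 1) / rho < M /\ C * D ^+ 2 < M]).
    split; first exact: qt0.
    by apply: filterI; apply: nbhs_pinfty_gt; exact: num_real.
  move=> [t M] /= [qt [M1 M2]]; rewrite in_itv/= => th e eM.
  have {}qt : `|q t0 - q t| < rho / 2 by apply: qt; rewrite /= in_itv.
  have ed : `|e *: d t| < rho / 2.
    rewrite normrZ; apply: (@le_lt_trans _ _ (`|e| * (D + 1))).
      by rewrite ler_wpM2l// (le_trans (dD t th))// lerDl.
    have D1 : 0 < D + 1 by rewrite ltr_wpDl.
    have M0 : 0 < M by apply: lt_trans M1; rewrite !divr_gt0// mulr_gt0.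
    rewrite ltr_pdivlMr//.
    move: M1; rewrite ltr_pdivrMr// => M1.
    have := ltr_pM2l M0; have : `|e| * (D + 1) * 2 <= `|e| * (M * rho).
      by rewrite -mulrA ler_wpM2l// mulrC ltW.
    move=> /le_lt_trans H _; apply: H; rewrite mulrA -[ltRHS]mul1r.
    by rewrite ltr_pM2r.
  have bt : ball (q t0) rho (q t).
    by rewrite -ball_normE /=; apply: (lt_trans qt); rewrite ltr_pdivrMr// ltr_pMr// ltr1n.
  have be : ball (q t0) rho (q t + e *: d t).
    rewrite -ball_normE /= opprD addrA; apply: (le_lt_trans (ler_normB _ _)).
    by rewrite [ltRHS](splitr rho) ltrD.
  split; first exact: HQr.
  have := HCr _ _ bt be; rewrite [q t + _]addrC addrK => /le_trans; apply.
  rewrite normrZ exprMn real_normK ?num_real// mulrCA mulrC.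
  rewrite ler_wpM2r ?sqr_ge0//; apply: (le_trans _ (ltW M2)).
  by rewrite ler_wpM2l// lerXn2r ?nnegrE ?dD.
have [M [M0 MP]] := filter_ex (filterI (nbhs_pinfty_gt (num_real 0)) PM).
by exists M => // e eM t th; apply: MP => //; rewrite /= in_itv.
Qed.

(** For the curve q + e d the gap estimate is quadratic in [e]: [b * D' ^+ 2] comes from the kinetic
    part, with its factor 1/2 dropped, and [M] from the potential. Hence the derivative at 0
    vanishes. *)
Lemma EL_critical (h : R) (q : R -> E) : 0 < h -> EL_solution Q L h q ->
  critical_curve Q L h (q 0) (q h) q.
Proof.
move=> h0 ELq; have admq := EL_admissible h0 ELq; split=> // d [pd d0 dh].
have [Cq qQ _] := ELq; have [g [dg _ qg]] := Cq.
have [D dD] := within_bounded (piecewise_C1_within pd).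
have [S [D' dd]] := piecewise_C1_derivable pd.
have [b b0 bP] := bilin_square_bound X Bl Br.
have [M M0 MP] := perturbation_quadratic (C1_on_within Cq) qQ dD.
apply: (@is_derive0_quadratic _ _ ((b * D' ^+ 2 + M) * h)).
have : \forall e \near (0 : R), `|e| < M^-1.
  by apply: nbhs0_lt; rewrite invr_gt0.
apply: filterS => e eM.
have {}eM : `|e| * M < 1 by rewrite -ltr_pdivlMr// mul1r.
have -> : (fun t => q t + 0 *: d t) = q.
  by apply/funext => t; rewrite scale0r addr0.
rewrite mulrAC.
apply: (action_gap X Bl Br sU (S := S)) => //.
  split; first exact: piecewise_C1_perturb.
  - by move=> t th; case: (MP e eM t th).
  - by rewrite d0 scaler0 addr0.
  - by rewrite dh scaler0 addr0.
move=> t th tS _; have th' : 0 <= t <= h by case/andP: th => /ltW -> /ltW ->.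
have [ddt ddD] := dd t th tS.
have [dq _] := derive1_eq_interval qg th (dg t).
have -> : derive1 (fun x => q x + e *: d x) t - derive1 q t = e *: derive1 d t.
  apply/eqP; rewrite subr_eq addrC; apply/eqP/is_derive1E.
  apply: (@is_deriveD R R E q (fun x => e *: d x)).
    exact: derivable_is_derive1.
  by apply: (@is_deriveZ R R E d); exact: derivable_is_derive1.
rewrite [q t + _]addrC addrK [_ + q t]addrC.
apply: (le_trans (ler_normB _ _)); rewrite mulrDl; apply: lerD; last first.
  by case: (MP e eM t th').
rewrite (bilinZl Bl) (bilinZr Br) !normrM ger0_norm ?invr_ge0//.
have D'0 : 0 <= D' by apply: le_trans ddD.
have -> : `|e| * (`|e| * `|B (derive1 d t) (derive1 d t)|) =
    `|B (derive1 d t) (derive1 d t)| * e ^+ 2.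
  by rewrite -[e ^+ 2]real_normK ?num_real//; ring.
rewrite mulrA ler_wpM2r ?sqr_ge0//.
apply: (@le_trans _ _ `|B (derive1 d t) (derive1 d t)|).
  by rewrite ler_piMl// invf_le1// ler1n.
apply: (le_trans (bP _)); rewrite ler_wpM2l// lerXn2r ?nnegrE//.
Qed.

End CriticalCurves.

(** * Short arcs at the initial time and interpolation on them *)

Section InitialArcs.
Context {R : realType}.

(* The pairs (h, t) with t in the arc ]0, h[, as h tends to 0. *)
Definition initial_arcs : set_system (R * R) :=
  [set A | exists2 d : R, 0 < d & forall h t, 0 < h < d -> 0 < t < h -> A (h, t)].

Global Instance initial_arcs_filter : Filter initial_arcs.
Proof.
split; first by exists 1.
- move=> A A' [d d0 dA] [d' d0' dA']; exists (Num.min d d').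
    by rewrite lt_min d0.
  move=> h t /andP[h0]; rewrite lt_min => /andP[hd hd'] th.
  by split; [apply: dA|apply: dA']; rewrite // h0.
- by move=> A A' AA' [d d0 dA]; exists d => // h t hd th; apply/AA'/dA.
Qed.

Lemma initial_arcs_open A : initial_arcs A ->
  initial_arcs [set p | \forall s \near p.2, A (p.1, s)].
Proof.
move=> [d d0 dA]; exists d => // h t hd th /=.
by apply: filterS (near_open_interval th) => s; exact: dA.
Qed.

Lemma near_initial_arcs (P : R -> Prop) : (\forall t \near (0 : R)^'+, P t) ->
  initial_arcs [set p | P p.2].
Proof.
move=> [d /= d0 dP]; exists d => // h t /andP[h0 hd] /andP[t0 th] /=.
by apply: dP => //=; rewrite sub0r normrN gtr0_norm// (lt_trans th hd).
Qed.

(** The instance with a trivial parameter, for the differentiability of the integrand along a single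
    polynomial piece. *)
Definition local_times (t0 : R) : set_system (unit * R) :=
  [set A | \forall s \near t0, A (tt, s)].

Global Instance local_times_filter t0 : Filter (local_times t0).
Proof.
split; first exact: (@filterT _ (nbhs t0)).
- by move=> A A' nA nA'; exact: (@filterI _ (nbhs t0) _ _ _ nA nA').
- by move=> A A' AA' nA; apply: (@filterS _ (nbhs t0) _ _ _ _ nA) => s /AA'.
Qed.

Lemma local_times_open t0 A : local_times t0 A ->
  local_times t0 [set p | \forall s \near p.2, A (p.1, s)].
Proof. by move=> /near_join. Qed.

(** The Taylor polynomial at h / 2 misses the end values by O(h^(l+1)). The affine function through
    these two errors has slope O(h^l), so adding it corrects the end values and preserves both error
    orders. All coefficients stay bounded as [h] tends to 0, which makes [Y] tame at every order. *)
Lemma interpolating_polynomial (f : R -> R) (l : nat) (T : R) : 0 < T ->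
  {within `[0, T], continuous f} ->
  (forall k, tame (F := initial_arcs) k (fun _ => f)) ->
  exists (Y : R -> {poly R}) (C d : R), [/\ 0 < d, 0 <= C,
    forall k, tame (F := initial_arcs) k (fun h => horner (Y h)) &
    forall h, 0 < h < d -> [/\ (0 < l)%N \/ f h = f 0 -> (size (Y h) <= l.+1)%N,
      (Y h).[0] = f 0, (Y h).[h] = f h,
      forall t, 0 <= t <= h -> `|f t - (Y h).[t]| <= C * h ^+ l.+1 &
      forall t, 0 < t < h -> `|derive1 f t - (Y h)^`().[t]| <= C * h ^+ l]].
Proof.
move=> T0 cf tf.
have [C [d0 d00 fC]] := tame_derive1n_bound (tf l.+2).
pose d := Num.min d0 (Num.min 1 T).
have dp : 0 < d by rewrite !lt_min d00 ltr01 T0.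
have fd (h t : R) m : 0 < h < d -> 0 < t < h -> (m <= l.+1)%N ->
    derivable (derive1n m f) t 1 /\ `|derive1n m f t| <= C.
  move=> /andP[h0]; rewrite lt_min => /andP[hd _] th ml.
  by apply: (fC h t _ th m ml); rewrite h0.
pose P h := taylor l.+1 f (h / 2).
pose r h t := f t - (P h).[t].
have hm (h : R) : 0 < h -> 0 < h / 2 < h by move=> h0; apply/andP; split; lra.
have dist (h t : R) : 0 < t < h -> `|t - h / 2| <= h.
  by move=> /andP[t0 th]; rewrite ler_norml; apply/andP; split; lra.
have C0 : 0 <= C.
  have h0 : 0 < d / 2 < d by exact: hm.
  have [] := fd (d / 2) _ 0%N h0 (hm _ _) _ => //; first by case/andP: h0.
  by move=> _; apply: le_trans.
have rC (h t : R) : 0 < h < d -> 0 <= t <= h -> `|r h t| <= C * h ^+ l.+1.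
  move=> hd; have /andP[h0 hd1] := hd.
  apply: (le_norm_closed (f := r h)) => //.
    apply: within_continuousB; last first.
      by apply: continuous_subspaceT; exact: continuous_horner.
    apply: (continuous_subitv cf) => //; apply/ltW/(lt_le_trans hd1).
    by rewrite !ge_min lexx !orbT.
  move=> {}t th; apply: le_trans (taylor_remainder (hm h h0) (C := C) _ _ th) _.
  - by move=> k s kl sh; case: (fd h s k hd sh (ltnW kl)).
  - by move=> s sh; case: (fd h s l.+1 hd sh (leqnn _)).
  by rewrite ler_wpM2l// lerXn2r ?nnegrE ?(ltW h0)// dist.
have r'C (h t : R) : 0 < h < d -> 0 < t < h ->
    `|derive1 f t - (P h)^`().[t]| <= C * h ^+ l.
  move=> hd th; have /andP[h0 hd1] := hd; rewrite /P deriv_taylor.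
  apply: le_trans (taylor_remainder (hm h h0) (C := C) _ _ th) _.
  - by move=> k s kl sh; rewrite -derive1Sn; case: (fd h s k.+1 hd sh (leqW kl)).
  - by move=> s sh; rewrite -derive1Sn; case: (fd h s l.+1 hd sh (leqnn _)).
  by rewrite ler_wpM2l// lerXn2r ?nnegrE ?(ltW h0)// dist.
pose a h := (r h h - r h 0) / h.
pose Y h := P h + (r h 0)%:P + a h *: 'X.
have YE h t : (Y h).[t] = (P h).[t] + r h 0 + a h * t.
  by rewrite !hornerD hornerC hornerZ hornerX.
have aC h : 0 < h < d -> `|a h| <= 2 * C * h ^+ l.
  move=> hd; have /andP[h0 _] := hd.
  rewrite normrM normfV (gtr0_norm h0) ler_pdivrMr//.
  apply: (le_trans (ler_normB _ _)).
  have -> : 2 * C * h ^+ l * h = C * h ^+ l.+1 + C * h ^+ l.+1 by rewrite exprS; ring.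
  by apply: lerD; apply: rC => //; rewrite lexx (ltW h0).
have h_le1 (h : R) : 0 < h < d -> h <= 1.
  by move=> /andP[_ /ltW/le_trans]; apply; rewrite !ge_min lexx !orbT.
(* The sum C + C + 2 C collects the remainder at [t], the remainder at 0 and the contribution of the
   slope. *)
exists Y, (4 * C), d; split => //.
- by rewrite mulr_ge0.
- move=> k.
  have near_h (c : R -> R) K : (forall h, 0 < h < d -> `|c h| <= K) ->
      exists K : R, \forall p \near initial_arcs, `|c p.1| <= K.
    by move=> cK; exists K, d => // h t hd _; exact: cK.
  apply: (tame_eq initial_arcs_open (f := fun h t =>
    (\sum_(k < l.+1) (derive1n k f (h / 2) / k`!%:R) * (t - h / 2) ^+ k + r h 0)
     + a h * t)).
    apply: nearW => p; rewrite YE /P /taylor horner_sum.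
    congr (_ + _ + _); apply: eq_bigr => i _.
    by rewrite hornerZ horner_exp hornerXsubC.
  apply: (tameD initial_arcs_open); first apply: (tameD initial_arcs_open).
  + apply: (tame_sum initial_arcs_open) => i; apply: (tameM initial_arcs_open).
      apply: (tame_cst _ (c := fun h => derive1n i f (h / 2) / i`!%:R)).
      apply: (near_h (fun h => derive1n i f (h / 2) / i`!%:R) C) => h hd.
      have /andP[h0 _] := hd; have [_] := fd h _ i hd (hm h h0) (ltnW (ltn_ord i)).
      rewrite normrM; apply: le_trans.
      rewrite normfV normr_nat ler_piMr// invf_le1 ?ltr0n ?fact_gt0//.
      by rewrite ler1n fact_gt0.
    apply: (tame_exp initial_arcs_open).
    apply: (tame_shift initial_arcs_open _ (m := fun h => h / 2)).
    by exists 1, d => // h t hd th /=; rewrite (le_trans (dist _ _ th))// h_le1.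
  + apply: (tame_cst _ (c := r ^~ 0)); apply: (near_h (r ^~ 0) C) => h hd.
    have /andP[h0 _] := hd.
    apply: (le_trans (rC h 0 hd _)); first by rewrite lexx ltW.
    by rewrite ler_piMr// exprn_ile1 ?h_le1// ltW.
  + apply: (tameM initial_arcs_open).
      apply: (tame_cst _ (c := a)); apply: (near_h a (2 * C)) => h hd.
      have /andP[h0 _] := hd.
      apply: (le_trans (aC h hd)).
      by rewrite ler_piMr ?mulr_ge0// exprn_ile1 ?h_le1// ltW.
    apply: (tame_eq initial_arcs_open (f := fun _ t => t - 0)).
      by apply: nearW => p; rewrite subr0.
    apply: (tame_shift initial_arcs_open _ (m := fun=> 0)).
    exists 1, d => // h t hd /andP[t0 th] /=.
    by rewrite subr0 gtr0_norm// (le_trans (ltW th))// h_le1.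
move=> h hd; have /andP[h0 _] := hd; split.
- move=> lf; apply: (leq_trans (size_polyD _ _)); rewrite geq_max; apply/andP; split.
    apply: (leq_trans (size_polyD _ _)); rewrite geq_max size_taylor/=.
    by rewrite (leq_trans (size_polyC_leq1 _)).
  (* For [l = 0] the Taylor polynomial is constant, so the slope is that of the chord of [f], which
     vanishes when the end values agree. *)
  have [l0|lpos] := posnP l; last first.
    by rewrite (leq_trans (size_scale_leq _ _))// size_polyX.
  have -> : a h = 0; last by rewrite scale0r size_poly0.
  case: lf => [|fh]; first by rewrite l0.
  rewrite /a /r /P l0 fh /taylor big_ord1 expr0 !hornerZ !hornerC.
  by rewrite subrr mul0r.
- by rewrite YE mulr0 addr0 /r addrC subrK.
- by rewrite YE /a divfK ?gt_eqF// /r; ring.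
- move=> t /andP[t0 th]; rewrite YE.
  have -> : f t - ((P h).[t] + r h 0 + a h * t) = r h t - r h 0 - a h * t by rewrite /r; ring.
  have -> : 4 * C * h ^+ l.+1 = C * h ^+ l.+1 + C * h ^+ l.+1 + (2 * C * h ^+ l) * h.
    by rewrite exprS; ring.
  apply: (le_trans (ler_normB _ _)); apply: lerD.
    by apply: (le_trans (ler_normB _ _)); apply: lerD; apply: rC;
      rewrite // ?t0 ?th ?lexx ?(ltW h0).
  by rewrite normrM (ger0_norm t0); apply: ler_pM => //; exact: aC.
- move=> t th.
  have -> : (Y h)^`().[t] = (P h)^`().[t] + a h.
    by rewrite /Y !derivD derivC addr0 derivZ derivX hornerD hornerZ hornerC mulr1.
  rewrite opprD addrA; have -> : 4 * C * h ^+ l = C * h ^+ l + 2 * C * h ^+ l + C * h ^+ l by ring.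
  apply: (le_trans (ler_normB _ _)).
  apply: (@le_trans _ _ (C * h ^+ l + 2 * C * h ^+ l)).
    by apply: lerD; [exact: r'C|exact: aC].
  by rewrite lerDl mulr_ge0// exprn_ge0// ltW.
Qed.

End InitialArcs.

(** * Regularity of solutions up to the initial time *)

Section ELRegularity.
Context {R : realType} {E : normedModType R} {I : finType} (X : coordinates E I).
Context (B : E -> E -> R).
Context (Bl : forall (a : R) v v' w, B (a *: v + v') w = a * B v w + B v' w).
Context (Br : forall (a : R) v w w', B v (a *: w + w') = a * B v w + B v w').
Context (U : E -> R) (Q : set E) (oQ : open Q) (sU : smooth_on Q U).
(* By nondegeneracy the velocity is a linear function of the momentum. *)
Context (dual : I -> E).
Context (dualE : forall i v, coordinate X i v = momentum B v (dual i)).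
Local Notation L := (natural_lagrangian B U).
Local Notation co := (coordinate X).
Local Notation e_ := (basis_vector X).

Lemma tame_lagrangian {J : Type} {F : set_system (J * R)} {FF : Filter F}
    (Fopen : forall A, F A -> F [set p | \forall s \near p.2, A (p.1, s)])
    (z v : J -> R -> E) (x0 : E) k :
  Q x0 -> z p.1 p.2 @[p --> F] --> x0 ->
  (forall i, tame (F := F) k (fun j t => co i (z j t))) ->
  (forall i, tame (F := F) k (fun j t => co i (v j t))) ->
  tame (F := F) k (fun j t => L (z j t, v j t)).
Proof.
move=> Qx0 zx0 tz tv.
apply: (tame_eq Fopen (f := fun j t =>
   2^-1 * (\sum_i \sum_j' co i (v j t) * co j' (v j t) * B (e_ i) (e_ j'))
   + -1 * U (z j t))).
  by apply: nearW => p; rewrite /natural_lagrangian /= (bilin_coords X Bl Br (v p.1 p.2)) mulN1r.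
apply: (tameD Fopen); apply: (tameZ Fopen); last exact: (tame_smooth_comp Fopen oQ Qx0 sU zx0 tz).
apply: (tame_sum Fopen) => i; apply: (tame_sum Fopen) => i'.
apply: (tameM Fopen); first exact: (tameM Fopen).
apply: (tame_cst _ (c := fun=> B (e_ i) (e_ i'))).
by exists `|B (e_ i) (e_ i')|; apply: nearW.
Qed.

Lemma start_near (T : R) (q : R -> E) : 0 < T -> {within `[0, T], continuous q} ->
  forall eps : R, 0 < eps -> \forall h \near (0 : R)^'+,
    forall t, 0 <= t <= h -> `|q 0 - q t| < eps.
Proof.
move=> T0 /(continuous_within_itvP _ T0)[_ q0 _] eps eps0.
have [d /= d0 dP] : \forall t \near (0 : R)^'+, `|q 0 - q t| < eps.
  by move/cvgrPdist_lt: q0; exact.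
exists d => // h /=; rewrite sub0r normrN => hd h0 t /andP[].
rewrite le_eqVlt => /predU1P[<- _|t0 th]; first by rewrite subrr normr0.
apply: dP => //=; rewrite sub0r normrN gtr0_norm// (le_lt_trans th)//.
by rewrite (le_lt_trans (ler_norm _) hd).
Qed.

(** Bootstrap from the C^1 regularity in [EL_solution]: a coordinate of the velocity is the momentum
    paired with [dual i], and its derivative is minus a directional derivative of [U] along [q]. If
    position and velocity are tame of order [k], that derivative is tame of order [k] as well, and
    one order is gained. *)
Lemma EL_coordinates_tame (T : R) (q : R -> E) : 0 < T -> EL_solution Q L T q ->
  forall k, (forall i, tame (F := initial_arcs) k (fun _ t => co i (q t))) /\
            (forall i, tame (F := initial_arcs) k (fun _ t => co i (derive1 q t))).
Proof.
move=> T0 ELq; have [Cq qQ _] := ELq; have [g [dg cg qg]] := Cq.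
have pE := EL_momentum Bl Br sU ELq.
have cq := C1_on_within Cq.
have [M M0 MP] := coordinate_bound X.
have dq t : 0 < t < T -> derivable q t 1 /\ derive1 q t = derive1 g t.
  by move=> tT; exact: derive1_eq_interval qg tT (dg t).
have inT : \forall p \near (@initial_arcs R), 0 < p.2 < T.
  by exists T => // h t /andP[_ hT] /andP[t0 th] /=; rewrite t0 (lt_trans th).
have q0Q : Q (q 0) by apply: qQ; rewrite lexx ltW.
have qcvg : q p.2 @[p --> (@initial_arcs R)] --> q 0.
  apply/cvgrPdist_lt => eps eps0.
  have := start_near T0 cq eps0 => st.
  have /near_initial_arcs : \forall t \near (0 : R)^'+, `|q 0 - q t| < eps.
    near=> h; have Hh : forall t, 0 <= t <= h -> `|q 0 - q t| < eps by near: h.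
    by apply: Hh; rewrite lexx andbT ltW.
  by [].
have [C qC] := within_bounded cq.
have [D gD] := within_bounded (continuous_subspaceT (A := `[0, T]) cg).
have le_in t : 0 < t < T -> 0 <= t <= T by move=> /andP[/ltW -> /ltW ->].
have bq i : exists K : R, \forall p \near (@initial_arcs R), `|co i (q p.2)| <= K.
  exists (M * C); apply: filterS inT => p /le_in pT.
  by apply: (le_trans (MP i _)); rewrite ler_wpM2l// qC.
have bdq i : exists K : R, \forall p \near (@initial_arcs R), `|co i (derive1 q p.2)| <= K.
  exists (M * D); apply: filterS inT => p pT.
  by apply: (le_trans (MP i _)); rewrite ler_wpM2l// (dq _ pT).2 gD ?le_in.
have iod := @initial_arcs_open R.
have pdual i : (fun s => momentum B (derive1 q s) (dual i)) =
    (fun s => co i (derive1 q s)) by apply/funext => s; rewrite dualE.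
elim=> [|k [tq tdq]]; first by split=> i; split.
split=> i; split; [exact: bq|split|exact: bdq|split].
- by apply: filterS inT => p /dq[/(is_derive_coord X i)[]].
- apply: (tame_eq iod _ (tdq i)); apply: filterS inT => p /dq[dqp _].
  exact/esym/is_derive1E/(is_derive_coord X i).
- by apply: filterS inT => p /pE/(_ (dual i)); rewrite pdual => -[].
- apply: (tame_eq iod (f := fun _ t => -1 * 'D_(dual i) U (q t))).
    apply: filterS inT => p /pE/(_ (dual i)); rewrite pdual => /is_derive1E ->.
    by rewrite mulN1r.
  apply: (tameZ iod).
  exact: (tame_smooth_comp iod oQ q0Q (smooth_derive (dual i) sU) qcvg tq).
Unshelve. all: by end_near. Qed.

End ELRegularity.

(** * The comparison curve *)

Section Comparison.
Context {R : realType} {E : normedModType R} {I : finType} (X : coordinates E I).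
Context (B : E -> E -> R).
Context (Bl : forall (a : R) v v' w, B (a *: v + v') w = a * B v w + B v' w).
Context (Br : forall (a : R) v w w', B v (a *: w + w') = a * B v w + B v w').
Context (U : E -> R) (Q : set E) (oQ : open Q) (sU : smooth_on Q U).
Context (dual : I -> E).
Context (dualE : forall i v, coordinate X i v = momentum B v (dual i)).
Local Notation L := (natural_lagrangian B U).
Local Notation co := (coordinate X).
Local Notation e_ := (basis_vector X).

Lemma C1_on_restrict {V : normedModType R} (a b b' : R) (q : R -> V) : b' <= b ->
  C1_on a b q -> C1_on a b' q.
Proof.
move=> bb [g [dg cg qg]]; exists g; split=> // t /andP[at' tb].
by apply: qg; rewrite at' (le_trans tb).
Qed.

Lemma EL_solution_restrict (L : E * E -> R) (h T : R) (q : R -> E) : h <= T ->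
  EL_solution Q L T q -> EL_solution Q L h q.
Proof.
move=> hT [Cq qQ EL]; split; first exact: C1_on_restrict Cq.
  by move=> t /andP[t0 th]; apply: qQ; rewrite t0 (le_trans th).
by move=> t /andP[t0 th]; apply: EL; rewrite t0 (lt_le_trans th).
Qed.

Definition polynomial_curve (Y : I -> {poly R}) (t : R) : E :=
  \sum_i (Y i).[t] *: e_ i.

Lemma is_derive_polynomial_curve (Y : I -> {poly R}) (t : R) :
  is_derive t 1 (polynomial_curve Y) (polynomial_curve (fun i => (Y i)^`()) t).
Proof.
by apply: is_derive_sumT => i; apply: is_derive_scalel; exact: is_derive_poly.
Qed.

Lemma polynomial_interpolants (l : nat) (T : R) (q : R -> E) : 0 < T ->
  EL_solution Q L T q ->
  exists (Y : I -> R -> {poly R}) (A : R), [/\ 0 <= A,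
    forall k i, tame (F := initial_arcs) k (fun h => horner (Y i h)) &
    \forall h \near (0 : R)^'+, [/\
      (0 < l)%N \/ q h = q 0 -> forall i, (size (Y i h) <= l.+1)%N,
      polynomial_curve (Y ^~ h) 0 = q 0, polynomial_curve (Y ^~ h) h = q h,
      forall t, 0 <= t <= h ->
        `|q t - polynomial_curve (Y ^~ h) t| <= A * h ^+ l.+1 &
      forall t, 0 < t < h ->
        `|derive1 q t - polynomial_curve (fun i => (Y i h)^`()) t| <= A * h ^+ l]].
Proof.
move=> T0 ELq; have [Cq qQ _] := ELq; have [g [dg _ qg]] := Cq.
have cq i : {within `[0, T], continuous (fun t => co i (q t))}.
  apply: (within_continuous_comp _ q (co i)); last exact: C1_on_within.
  by move=> ? _; exact: coordinate_continuous.
have interp i := interpolating_polynomial l T0 (cq i)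
  (fun k => (EL_coordinates_tame Bl Br oQ sU dualE T0 ELq k).1 i).
have [Y YP] := choice interp; have [C CP] := choice YP; have [d dP] := choice CP.
exists Y, (\sum_i C i * `|e_ i|); split.
- by apply: sumr_ge0 => i _; rewrite mulr_ge0//; case: (dP i).
- by move=> k i; case: (dP i).
have hd : \forall h \near (0 : R)^'+, forall i, 0 < h < d i.
  apply: filter_forall => i; have [di0 _ _ _] := dP i.
  near=> h; apply/andP; split; near: h; [exact: nbhs_right_gt|exact: nbhs_right_lt].
near=> h.
have hdi i : 0 < h < d i by move: i; near: h.
have h0 : 0 < h by near: h; exact: nbhs_right_gt.
have hT : h < T by near: h; exact: nbhs_right_lt.
have Yh i := (let: And4 _ _ _ H := dP i in H h (hdi i)).
split.
- move=> lq i; have [+ _ _ _ _] := Yh i; apply.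
  by case: lq => [->|->]; [left|right].
- rewrite [RHS](coordinate_basis X); apply: eq_bigr => i _.
  by have [_ -> _ _ _] := Yh i.
- rewrite [RHS](coordinate_basis X); apply: eq_bigr => i _.
  by have [_ _ -> _ _] := Yh i.
- move=> t th; rewrite mulr_suml.
  under [leRHS]eq_bigr do rewrite mulrAC.
  apply: (norm_le_coordinates (X := X)) => i.
  by rewrite coordinateB coordinate_sum; have [_ _ _ + _] := Yh i; exact.
- move=> t th; rewrite mulr_suml.
  under [leRHS]eq_bigr do rewrite mulrAC.
  apply: (norm_le_coordinates (X := X)) => i.
  rewrite coordinateB coordinate_sum; have [_ _ _ _ /(_ t th)] := Yh i.
  have tT : 0 < t < T by case/andP: th => -> /lt_trans ->.
  have [dq _] := derive1_eq_interval qg tT (dg t).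
  by rewrite (is_derive1E (is_derive_coord X i dq)).
Unshelve. all: by end_near. Qed.

(** The curve [y] tends to [q 0], hence stays in [Q], and its coordinates are tame; so the constant
    [K] for the [u]-th derivative does not depend on [h]. The gap is stated for any admissible [z]
    that agrees with [y] on [0, h], since a curve glued from micro pieces is equal to [y] only
    there. *)
Lemma comparison_curve (l u : nat) (T : R) (q : R -> E) : 0 < T ->
  EL_solution Q L T q ->
  exists (Y : I -> R -> {poly R}) (M K d : R), [/\ 0 < d, d <= T &
    forall h, 0 < h < d -> (0 < l)%N \/ q h = q 0 ->
    let y := polynomial_curve (Y ^~ h) in
    let y' := polynomial_curve (fun i => (Y i h)^`()) in
    [/\ forall i, (size (Y i h) <= l.+1)%N,
      y 0 = q 0 /\ y h = q h,
      forall t, 0 <= t <= h -> Q (y t),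
      forall t, 0 < t < h -> `|derive1n u (fun s => L (y s, y' s)) t| <= K &
      forall z, admissible_curve Q h (q 0) (q h) z ->
        (forall t, 0 <= t <= h -> z t = y t) ->
        `|action L h z - action L h q| <= M * h ^+ (2 * l + 1)]].
Proof.
move=> T0 ELq; have [Cq qQ _] := ELq.
have q0Q : Q (q 0) by apply: qQ; rewrite lexx ltW.
have [Y [A [A0 tY YP]]] := polynomial_interpolants l T0 ELq.
pose y h := polynomial_curve (Y ^~ h).
pose y' h := polynomial_curve (fun i => (Y i h)^`()).
have cq := C1_on_within Cq.
have iod := @initial_arcs_open R.
have near_arcs (P : R -> R -> Prop) :
    (\forall h \near (0 : R)^'+, forall t, 0 <= t <= h -> P h t) ->
    \forall p \near (@initial_arcs R), P p.1 p.2.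
  move=> [d /= d0 dP]; exists d => // h t /andP[h0 hd] /andP[t0 th] /=.
  by apply: dP; rewrite //= ?(ltW t0) ?(ltW th)// sub0r normrN gtr0_norm.
have ycl (eps : R) : 0 < eps ->
    \forall h \near (0 : R)^'+, forall t, 0 <= t <= h -> `|q 0 - y h t| < eps.
  move=> eps0; have eps2 : 0 < eps / 2 by rewrite divr_gt0.
  have A1 : 0 < A + 1 by rewrite ltr_wpDl.
  have := start_near T0 cq eps2 => st.
  near=> h => t th.
  have h0 : 0 < h by near: h; exact: nbhs_right_gt.
  have h1 : h <= 1 by near: h; exact: nbhs_right_le.
  have hA : h < eps / 2 / (A + 1) by near: h; apply: nbhs_right_lt; rewrite divr_gt0.
  have [_ _ _ yq _] : [/\ (0 < l)%N \/ q h = q 0 -> forall i, (size (Y i h) <= l.+1)%N,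
      y h 0 = q 0, y h h = q h,
      forall t, 0 <= t <= h -> `|q t - y h t| <= A * h ^+ l.+1 &
      forall t, 0 < t < h -> `|derive1 q t - y' h t| <= A * h ^+ l] by near: h.
  have sth : forall t, 0 <= t <= h -> `|q 0 - q t| < eps / 2 by near: h.
  rewrite -(subrK (q t) (q 0)) -addrA [eps]splitr.
  apply: (le_lt_trans (ler_normD _ _)); apply: ltrD; first exact: sth.
  apply: (le_lt_trans (yq t th)); apply: (@le_lt_trans _ _ ((A + 1) * h)).
    apply: ler_pM; rewrite ?exprn_ge0 ?(ltW h0) ?lerDl//.
    by rewrite exprS ler_piMr ?exprn_ile1 ?(ltW h0).
  by rewrite mulrC -ltr_pdivlMr.
have ycvg : y p.1 p.2 @[p --> (@initial_arcs R)] --> q 0.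
  apply/cvgrPdist_lt => eps eps0.
  exact: (near_arcs (fun h t => `|q 0 - y h t| < eps) (ycl eps eps0)).
have tL : tame (F := initial_arcs) u.+1 (fun h t => L (y h t, y' h t)).
  apply: (tame_lagrangian Bl Br oQ sU iod (X := X) (z := y) (v := y') q0Q ycvg) => i.
    by apply: (tame_eq iod _ (tY u.+1 i)); apply: nearW => p; rewrite coordinate_sum.
  have tY' : tame (F := initial_arcs) u.+1 (fun h => derive1 (horner (Y i h))) :=
    (tY u.+2 i).2.2.
  by apply: (tame_eq iod _ tY'); apply: nearW => p; rewrite coordinate_sum derivE.
have [K [d1 d10 d1P]] := tame_derive1n_bound tL.
have [b b0 bP] := bilin_square_bound X Bl Br.
have [Ct [Ct0 CtP]] := smooth_local_taylor X oQ sU q0Q.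
have HQ := near0_ball (open_nbhs_nbhs (conj oQ q0Q)).
have [rho [HQr [HCr rho0]]] := filter_ex (filterI HQ (filterI CtP (nbhs_right_gt (0 : R)))).
have yrho := ycl rho rho0; have qrho := start_near T0 cq rho0.
have d1near : \forall h \near (0 : R)^'+, h < d1 by exact: nbhs_right_lt.
have one_near : \forall h \near (0 : R)^'+, h <= 1 by exact: nbhs_right_le.
have [d2 /= d20 d2P] := filterI (filterI YP (filterI yrho qrho)) (filterI d1near one_near).
(* The kinetic term is quadratic in the velocity error, at most A h^l; the potential term is
   quadratic in the position error, at most A h^(l+1) <= A h^l. The length of the interval supplies
   the last factor of h^(2l+1). *)
exists Y, (2^-1 * (b * A ^+ 2) + Ct * A ^+ 2), K, (Num.min d2 T); split.
- by rewrite lt_min d20.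
- by rewrite ge_min lexx orbT.
move=> h /andP[h0]; rewrite lt_min => /andP[hd2 hT] lq /=.
have hball : `|0 - h| < d2 by rewrite sub0r normrN gtr0_norm.
have [[Yh [yh qh]] [hd1 h1]] := d2P h hball h0.
have [sz y0 yhh yq yq'] := Yh; split => //.
- exact: sz.
- move=> t th; apply: HQr; rewrite -ball_normE /=; exact: yh.
- by move=> t th; have [] := d1P h t _ th u (leqnn _); rewrite ?h0.
move=> z admz zy.
rewrite addn1 [h ^+ _]exprSr [_ * (h ^+ _ * h)]mulrA.
apply: (action_gap X Bl Br sU (S := [::])) => //.
  exact: EL_solution_restrict (ltW hT) ELq.
move=> t th _ _; have th' : 0 <= t <= h by case/andP: th => /ltW -> /ltW ->.
have [_ ->] := derive1_eq_interval zy th (ex_derive (is_derive := is_derive_polynomial_curve (Y ^~ h) t)).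
rewrite (is_derive1E (is_derive_polynomial_curve (Y ^~ h) t)) zy//.
have hl : h ^+ l.+1 <= h ^+ l by rewrite exprSr ler_piMr ?exprn_ge0 ?(ltW h0).
have h2l : h ^+ (2 * l) = (h ^+ l) ^+ 2 by rewrite mulnC exprM.
rewrite mulrDl; apply: (le_trans (ler_normB _ _)); apply: lerD.
  rewrite normrM ger0_norm ?invr_ge0// -mulrA ler_wpM2l ?invr_ge0//.
  apply: (le_trans (bP _)); rewrite -mulrA ler_wpM2l// h2l -exprMn.
  by rewrite distrC lerXn2r ?nnegrE ?mulr_ge0 ?exprn_ge0 ?(ltW h0)// yq'.
apply: (le_trans (HCr _ _ _ _)); [by rewrite -ball_normE; exact: qh|by rewrite -ball_normE; exact: yh|].
rewrite -mulrA ler_wpM2l// h2l -exprMn distrC.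
rewrite lerXn2r ?nnegrE ?mulr_ge0 ?exprn_ge0 ?(ltW h0)//.
by apply: (le_trans (yq t th')); rewrite ler_wpM2l.
Unshelve. all: by end_near. Qed.

End Comparison.

(** * Closure properties of smooth functions *)

Section Smoothness.
Context {R : realType} {E : normedModType R}.
Implicit Types (Q : set E) (f g : E -> R).

Lemma near_eq_differentiable f g x : (\forall y \near x, f y = g y) ->
  differentiable f x -> differentiable g x.
Proof.
move=> fg /diff_locallyP[cdf fE].
have gE : g \o shift x = cst (g x) + 'd f x +o_ (0 : E) id.
  apply/eqaddoP => eps eps0; move/eqaddoP: fE => /(_ eps eps0).
  have shx : (fun y => y + x) @ (0 : E) --> x.
    by rewrite -{2}[x]add0r; apply: cvgD; [exact: cvg_id|exact: cvg_cst].
  have fgs : \forall y \near (0 : E), f (y + x) = g (y + x) by exact: shx _ fg.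
  apply: filterS2 fgs => y /= fgy.
  by rewrite !fctE /= fgy (nbhs_singleton fg).
by apply/diff_locallyP; rewrite (diff_unique cdf gE).
Qed.

(** Derivatives at a point of [Q] look at a whole neighbourhood; since [Q] is open, agreement on [Q]
    is agreement near each of its points. *)
Lemma Ck_on_eq k Q f g : open Q -> (forall x, Q x -> f x = g x) ->
  Ck_on k Q f -> Ck_on k Q g.
Proof.
move=> oQ; elim: k f g => [|k IH] f g fg.
  move=> cf x Qx; rewrite /prop_for /continuous_at -fg//.
  apply: cvg_trans (cf x Qx); apply: near_eq_cvg.
  by apply: filterS (open_nbhs_nbhs (conj oQ Qx)) => y /fg.
have near_fg x : Q x -> \forall y \near x, f y = g y.
  by move=> Qx; apply: filterS (open_nbhs_nbhs (conj oQ Qx)) => y /fg.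
move=> [df Df]; split=> [x Qx|w].
  by apply: near_eq_differentiable (near_fg x Qx) (df x Qx).
apply: (IH (fun x => 'D_w f x)) => [x Qx|]; last exact: Df.
by apply: near_eq_derive; exact: near_fg.
Qed.

Lemma smooth_onD Q f g : open Q -> smooth_on Q f -> smooth_on Q g ->
  smooth_on Q (fun x => f x + g x).
Proof.
move=> oQ + + k; elim: k f g => [|k IH] f g sf sg.
  by move=> x Qx; apply: cvgD; [exact: (sf 0%N)|exact: (sg 0%N)].
split=> [x Qx|w].
  by apply: differentiableD; [exact: (sf 1%N).1|exact: (sg 1%N).1].
apply: (@Ck_on_eq _ _ (fun x => 'D_w f x + 'D_w g x)) => //.
  move=> x Qx; apply/esym/deriveD; apply: diff_derivable.
    exact: (sf 1%N).1.
  exact: (sg 1%N).1.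
by apply: IH => n; [exact: (sf n.+1).2|exact: (sg n.+1).2].
Qed.

End Smoothness.

Lemma smooth_on_snd {R : realType} {E1 E2 : normedModType R} (Q1 : set E1) (Q2 : set E2)
  (W : E2 -> R) : smooth_on Q2 W -> smooth_on (Q1 `*` Q2) (fun x : E1 * E2 => W x.2).
Proof.
move=> + k; elim: k W => [|k IH] W sW.
  move=> x [_ Qx]; apply: (@cvg_comp _ _ _ snd W _ (nbhs x.2)); first exact: cvg_snd.
  exact: (sW 0%N).
split=> [x [_ Qx]|w].
  apply: (@differentiable_comp _ _ _ _ snd W); last exact: (sW 1%N).1.
  by apply: linear_differentiable => z; exact: cvg_snd.
by apply: (IH (fun y => 'D_(w.2) W y)) => n; exact: (sW n.+1).2.
Qed.

(** * Coordinates and mass form of the multirate system *)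

Section PairCoordinates.
Context {R : realType} {m n : nat}.
Local Notation E := ('cV[R]_m * 'cV[R]_n)%type.
Local Notation I := ('I_m + 'I_n)%type.

Definition pair_coordinate (i : I) (v : E) : R :=
  match i with inl i => v.1 i 0 | inr j => v.2 j 0 end.

Definition pair_basis (i : I) : E :=
  match i with inl i => (delta_mx i 0, 0) | inr j => (0, delta_mx j 0) end.

Fact pair_coordinate_linear i (a : R) v w :
  pair_coordinate i (a *: v + w) = a * pair_coordinate i v + pair_coordinate i w.
Proof. by case: i => i; rewrite /= !mxE. Qed.

Fact pair_coordinate_continuous i : continuous (pair_coordinate i).
Proof.
case: i => i v.
  apply: (@cvg_comp _ _ _ fst (fun M : 'cV[R]_m => M i 0) _ (nbhs v.1)).
    exact: cvg_fst.
  exact: coord_continuous.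
apply: (@cvg_comp _ _ _ snd (fun M : 'cV[R]_n => M i 0) _ (nbhs v.2)).
  exact: cvg_snd.
exact: coord_continuous.
Qed.

Fact pair_coordinate_basis v : v = \sum_i pair_coordinate i v *: pair_basis i.
Proof.
have fstS (K : finType) (f : K -> E) : (\sum_i f i).1 = \sum_i (f i).1.
  by elim/big_rec2: _ => // i y1 y2 _ <-.
have sndS (K : finType) (f : K -> E) : (\sum_i f i).2 = \sum_i (f i).2.
  by elim/big_rec2: _ => // i y1 y2 _ <-.
apply: injective_projections; rewrite ?fstS ?sndS big_sumType /=.
  rewrite [X in _ + X]big1 ?addr0 => [|i _]; last by rewrite scaler0.
  apply/colP => k; rewrite summxE (bigD1 k)//= big1 ?addr0 => [|i ik].
    by rewrite !mxE !eqxx mulr1.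
  by rewrite !mxE eq_sym (negbTE ik) mulr0.
rewrite [X in X + _]big1 ?add0r => [|i _]; last by rewrite scaler0.
apply/colP => k; rewrite summxE (bigD1 k)//= big1 ?addr0 => [|i ik].
  by rewrite !mxE !eqxx mulr1.
by rewrite !mxE eq_sym (negbTE ik) mulr0.
Qed.

Fact pair_coordinate_basis_vector i j :
  pair_coordinate i (pair_basis j) = (i == j)%:R.
Proof. by case: i => i; case: j => j; rewrite /= !mxE ?andbT. Qed.

Definition pair_coordinates : coordinates E I :=
  Coordinates pair_coordinate_linear pair_coordinate_continuous
    pair_coordinate_basis pair_coordinate_basis_vector.

End PairCoordinates.

Section Multirate.
Context {R : realType} {ns nf : nat}.
Local Notation E := ('cV[R]_ns * 'cV[R]_nf)%type.
Local Notation I := ('I_ns + 'I_nf)%type.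
Context (Ms : 'M[R]_ns) (Mf : 'M[R]_nf).

Definition mass_form (v w : E) : R :=
  (v.1^T *m Ms *m w.1) 0 0 + (v.2^T *m Mf *m w.2) 0 0.

Lemma mass_form_linearl (a : R) v v' w :
  mass_form (a *: v + v') w = a * mass_form v w + mass_form v' w.
Proof.
rewrite /mass_form /= !linearP /= !mulmxDl -!scalemxAl !mxE; ring.
Qed.

Lemma mass_form_linearr (a : R) v w w' :
  mass_form v (a *: w + w') = a * mass_form v w + mass_form v w'.
Proof.
rewrite /mass_form /= !linearP /= !mxE; ring.
Qed.

Lemma multirate_natural (V : E -> R) (W : 'cV[R]_nf -> R) :
  multirate_lagrangian Ms Mf V W = natural_lagrangian mass_form (fun x => V x + W x.2).
Proof.
apply/funext => z; rewrite /multirate_lagrangian /natural_lagrangian /mass_form.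
by rewrite mulrDr opprD addrA.
Qed.

Definition sym_part {n} (M : 'M[R]_n) : 'M[R]_n := 2^-1 *: (M + M^T).

Lemma sym_part_form {n} (M : 'M[R]_n) (v w : 'cV[R]_n) :
  2^-1 * ((v^T *m M *m w) 0 0 + (w^T *m M *m v) 0 0) = (v^T *m sym_part M *m w) 0 0.
Proof.
have -> : (w^T *m M *m v) 0 0 = (v^T *m M^T *m w) 0 0.
  by rewrite -[in LHS](trmxK (w^T *m M *m v)) [LHS]mxE !trmx_mul trmxK mulmxA.
by rewrite /sym_part -scalemxAr -scalemxAl mulmxDr mulmxDl !mxE.
Qed.

Lemma momentum_mass v w : momentum mass_form v w =
  (v.1^T *m sym_part Ms *m w.1) 0 0 + (v.2^T *m sym_part Mf *m w.2) 0 0.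
Proof.
by rewrite -!sym_part_form /momentum /mass_form; ring.
Qed.

Lemma sym_part_unit {n} (M : 'M[R]_n) :
  (forall w : 'cV[R]_n, sym_part M *m w = 0 -> w = 0) -> sym_part M \in unitmx.
Proof.
move=> inj; rewrite -row_free_unit; apply: inj_row_free => v v0.
have symT : (sym_part M)^T = sym_part M.
  by rewrite /sym_part linearZ /= linearD /= trmxK addrC.
apply: trmx_inj; rewrite trmx0; apply: inj.
by rewrite -{1}symT -trmx_mul v0 trmx0.
Qed.

(** Basis vectors pulled back by the symmetrised mass matrices: pairing the momentum with them
    recovers the coordinates of the velocity. *)
Definition mass_dual (i : I) : E :=
  match i with
  | inl i => (invmx (sym_part Ms) *m delta_mx i 0, 0)
  | inr j => (0, invmx (sym_part Mf) *m delta_mx j 0)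
  end.

(** The second velocity derivative of the Lagrangian is the constant symmetrised mass form, so
    regularity at the single state [(x, 0)] makes that form nondegenerate. The vectors [(w, 0)] and
    [(0, w)] then show that both symmetric parts are invertible. *)
Lemma mass_dualP (Q : set E) (V : E -> R) (W : 'cV[R]_nf -> R) x :
  Q x -> regular_lagrangian Q (multirate_lagrangian Ms Mf V W) ->
  forall i v, coordinate pair_coordinates i v = momentum mass_form v (mass_dual i).
Proof.
move=> Qx reg.
have nondeg w : (forall v, momentum mass_form v w = 0) -> w = 0.
  move=> w0; apply: (reg x 0 Qx) => w'.
  have -> : (fun z => 'D_(0, w) (multirate_lagrangian Ms Mf V W) z) = cst 0.
    apply/funext => -[y v]; rewrite multirate_natural.
    rewrite (derive_val (is_derive := derive_velocity mass_form_linearl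
      mass_form_linearr _ w y v)).
    exact: w0.
  exact: derive_cst.
have us : sym_part Ms \in unitmx.
  apply: sym_part_unit => w w0; have := nondeg (w, 0).
  have w00 v : momentum mass_form v (w, 0) = 0.
    by rewrite momentum_mass /= -!mulmxA w0 !mulmx0 !mxE addr0.
  by move=> /(_ w00) [].
have uf : sym_part Mf \in unitmx.
  apply: sym_part_unit => w w0; have := nondeg (0, w).
  have w00 v : momentum mass_form v (0, w) = 0.
    by rewrite momentum_mass /= -!mulmxA w0 !mulmx0 !mxE addr0.
  by move=> /(_ w00) [].
case=> i v; rewrite momentum_mass /= !mulmx0 -mulmxA mulKVmx// -colE !mxE.
  by rewrite addr0.
by rewrite add0r.
Qed.

End Multirate.

(** * Polynomial pieces and discrete curves *)

Lemma tame_horner {R : realType} (t : R) (P : {poly R}) k :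
  tame (F := local_times t) k (fun _ => horner P).
Proof.
have b (P0 : {poly R}) : exists C : R, \forall p \near local_times t, `|P0.[p.2]| <= C.
  exists (`|P0.[t]| + 1).
  have cP : P0.[s] @[s --> t] --> P0.[t] by exact: continuous_horner.
  have : \forall s \near t, `|P0.[s]| <= `|P0.[t]| + 1.
    by move/cvgr_norm_le: cP; apply; rewrite ltrDl.
  by [].
elim: k P => [|k IH] P; split => //; split.
  apply: (@filterS _ (local_times t) _ setT); last exact: filterT.
  by move=> s _; exact: derivable_horner.
by have := IH P^`(); rewrite derivE.
Qed.

Section PolynomialPieces.
Context {R : realType} {E : normedModType R} {I : finType} (X : coordinates E I).
Context (B : E -> E -> R).
Context (Bl : forall (a : R) v v' w, B (a *: v + v') w = a * B v w + B v' w).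
Context (Br : forall (a : R) v w w', B v (a *: w + w') = a * B v w + B v w').
Context (U : E -> R) (Q : set E) (oQ : open Q) (sU : smooth_on Q U).
Local Notation L := (natural_lagrangian B U).

Lemma polynomial_curve_continuous (Y : I -> {poly R}) :
  continuous (polynomial_curve X Y).
Proof.
by move=> t; apply: derivable_continuous_at; case: (is_derive_polynomial_curve X Y t).
Qed.

Lemma polynomial_integrand_derivable (Y : I -> {poly R}) (t : R) k :
  Q (polynomial_curve X Y t) ->
  derivable (derive1n k (fun s => L (polynomial_curve X Y s,
     polynomial_curve X (fun i => (Y i)^`()) s))) t 1.
Proof.
move=> Qt.
have lo := @local_times_open R t.
have zx : polynomial_curve X Y p.2 @[p --> local_times t] --> polynomial_curve X Y t.
  exact: (@polynomial_curve_continuous Y t).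
have tL : tame (F := local_times t) k.+1 (fun _ s => L (polynomial_curve X Y s,
     polynomial_curve X (fun i => (Y i)^`()) s)).
  apply: (tame_lagrangian Bl Br oQ sU lo (X := X) (z := fun _ => polynomial_curve X Y)
    (v := fun _ => polynomial_curve X (fun i => (Y i)^`())) Qt zx) => i.
    apply: (tame_eq lo _ (tame_horner t (Y i) k.+1)).
    by apply: nearW => p; rewrite coordinate_sum.
  apply: (tame_eq lo _ (tame_horner t (Y i)^`() k.+1)).
  by apply: nearW => p; rewrite coordinate_sum.
have [C CP] := tame_derive1n_bound tL.
have H : \forall s \near t, forall m, (m <= k)%N -> _ := CP.
by have [] := nbhs_singleton H k (leqnn _).
Qed.

Lemma polynomial_integrand_continuous (Y : I -> {poly R}) (t : R) :
  Q (polynomial_curve X Y t) ->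
  {for t, continuous (fun s => L (polynomial_curve X Y s,
     polynomial_curve X (fun i => (Y i)^`()) s))}.
Proof.
by move=> Qt; apply: derivable_continuous_at; exact: (polynomial_integrand_derivable (k := 0%N) Qt).
Qed.

End PolynomialPieces.

Section DiscreteCurves.
Context {R : realType} {ns nf : nat}.
Local Notation E := ('cV[R]_ns * 'cV[R]_nf)%type.
Local Notation I := ('I_ns + 'I_nf)%type.
Local Notation X := (@pair_coordinates R ns nf).

Definition micro_piece {p} (x : @dcurve R ns nf p) (m : 'I_p) (i : I) : {poly R} :=
  match i with inl i => x.1 i 0 | inr j => x.2 m j 0 end.

Lemma dpositionE p (x : @dcurve R ns nf p) (m : 'I_p) :
  dposition x m = polynomial_curve X (micro_piece x m).
Proof.
apply/funext => t; apply: (coordinate_inj (X := X)) => i.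
by rewrite coordinate_sum; case: i => i; rewrite /= !mxE.
Qed.

Lemma dvelocityE p (x : @dcurve R ns nf p) (m : 'I_p) :
  dvelocity x m = polynomial_curve X (fun i => (micro_piece x m i)^`()).
Proof.
apply/funext => t; apply: (coordinate_inj (X := X)) => i.
by rewrite coordinate_sum; case: i => i; rewrite /= !mxE.
Qed.

Lemma micro_cover p (dt t : R) : (0 < p)%N -> 0 <= t <= p%:R * dt ->
  exists m : 'I_p, in_micro dt m t.
Proof.
case: p => // p _; elim: p => [|p IH] /andP[t0 tp].
  by exists ord0; rewrite /in_micro mul0r t0.
have [tle|tge] := lerP t (p.+1%:R * dt).
  have [|m mt] := IH; first by rewrite t0.
  by exists (widen_ord (leqnSn _) m).
by exists ord_max; rewrite /in_micro/= (ltW tge).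
Qed.

(** Distinct micro intervals meet at most in a node, and only if they are consecutive; there the
    continuity condition of [multirate_space] applies. *)
Lemma dposition_glue l p (dt : R) (x : @dcurve R ns nf p) : 0 < dt -> multirate_space l dt x ->
  forall (m m' : 'I_p) t, in_micro dt m t -> in_micro dt m' t ->
  dposition x m t = dposition x m' t.
Proof.
move=> dt0 [_ _ glue] m m' t; wlog mm : m m' / (m <= m')%N.
  by move=> H mt m't; case: (leqP m m') => [|/ltnW] mm; [|apply/esym]; exact: H.
move=> /andP[mt tm] /andP[m't tm'].
move: mm; rewrite leq_eqVlt => /orP[/eqP/ord_inj -> //|mm].
have tE : t = m'%:R * dt.
  apply/eqP; rewrite eq_le m't andbT; apply: (le_trans tm).
  by rewrite ler_wpM2r ?ler_nat ?(ltW dt0).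
have m'E : m' = m.+1 :> nat.
  apply/eqP; rewrite eqn_leq mm andbT.
  have := le_trans m't tm; by rewrite ler_pM2r// ler_nat.
by rewrite /dposition tE glue.
Qed.

Context (Ms : 'M[R]_ns) (Mf : 'M[R]_nf).
Context (U : E -> R) (Q : set E) (oQ : open Q) (sU : smooth_on Q U).
Local Notation L := (natural_lagrangian (mass_form Ms Mf) U).
Local Notation Bl := (mass_form_linearl Ms Mf).
Local Notation Br := (mass_form_linearr Ms Mf).

(** Glued together, the pieces form a piecewise C^1 competitor [z] for the continuous problem. On
    each micro interval the integrand comes from one polynomial piece and is smooth, so the
    quadrature error applies there, and the [p] errors are added. *)
Lemma discrete_action_error (l r u : nat) (b c : 'I_r -> R) p (dt K : R) q0 q1
    (x : @dcurve R ns nf p) :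
  quadrature_order b c u -> (forall i, 0 <= c i <= 1) ->
  (0 < p)%N -> 0 < dt -> dadmissible Q l dt q0 q1 x ->
  (forall (m : 'I_p) t, m%:R * dt < t < m.+1%:R * dt ->
     `|derive1n u (dintegrand L x m) t| <= K) ->
  exists z, [/\ admissible_curve Q (p%:R * dt) q0 q1 z,
    forall (m : 'I_p) t, in_micro dt m t -> z t = dposition x m t &
    `|action L (p%:R * dt) z - discrete_action L b c dt x|
      <= quadrature_constant b * K * (p%:R * dt ^+ u.+1)].
Proof.
move=> ord c01 p0 dt0 [xsp xQ [x0 x1]] xK.
(* Outside the macro interval the value is the default 0; at a node it does not matter which of the
   two pieces is selected. *)
pose z t := if pselect (exists m : 'I_p, in_micro dt m t) is left H
            then dposition x (projT1 (cid H)) t else 0.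
have zE (m : 'I_p) t : in_micro dt m t -> z t = dposition x m t.
  move=> mt; rewrite /z; case: pselect => [H|[]]; last by exists m.
  exact: (dposition_glue dt0 xsp (projT2 (cid H)) mt).
have S1 (j : nat) : j.+1%:R * dt = j%:R * dt + dt by rewrite -natr1 mulrDl mul1r.
have pz : piecewise_C1 (p%:R * dt) z.
  exists p, (fun j => j%:R * dt); split=> //; first by rewrite mul0r.
    by move=> j _; rewrite S1 ltrDl.
  move=> j jp; pose m := Ordinal jp.
  exists (dposition x m); split.
  - by move=> t; rewrite dpositionE; case: (is_derive_polynomial_curve X (micro_piece x m) t).
  - have -> : derive1 (dposition x m) = polynomial_curve X (fun i => (micro_piece x m i)^`()).
      by apply/funext => t; rewrite dpositionE; exact/is_derive1E/is_derive_polynomial_curve.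
    exact: polynomial_curve_continuous.
  - by move=> t tm; apply: (zE m).
have zQ t : 0 <= t <= p%:R * dt -> Q (z t).
  by move=> /(micro_cover p0)[m mt]; rewrite (zE m t mt); exact: xQ.
have adm : admissible_curve Q (p%:R * dt) q0 q1 z.
  split => //.
    rewrite (zE (Ordinal p0)); first exact: x0.
    by rewrite /in_micro /= mul0r lexx mul1r ltW.
  have pp : (p.-1 < p)%N by rewrite prednK.
  rewrite (zE (Ordinal pp)); first by apply: x1; rewrite /= prednK.
  by rewrite /in_micro /= prednK// lexx andbT ler_wpM2r ?(ltW dt0)// ler_nat leq_pred.
exists z; split => //.
have [F [S [cF dF ->]]] := action_primitive X Bl Br sU pz zQ.
have -> : F (p%:R * dt) - F 0 = \sum_(m < p) (F (m%:R * dt + dt) - F (m%:R * dt)).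
  under eq_bigr do rewrite -S1.
  rewrite -(big_mkord xpredT (fun m => F (m.+1%:R * dt) - F (m%:R * dt))).
  by rewrite telescope_sumr// mul0r.
rewrite /discrete_action mulr_sumr -sumrB.
have -> : quadrature_constant b * K * (p%:R * dt ^+ u.+1) =
  \sum_(m < p) quadrature_constant b * K * dt ^+ u.+1.
  by rewrite sumr_const card_ord -mulr_natr; ring.
apply: (le_trans (ler_norm_sum _ _ _)); apply: ler_sum => m _.
have m0 : 0 <= m%:R * dt by rewrite mulr_ge0 ?(ltW dt0).
have mp : m%:R * dt + dt <= p%:R * dt by rewrite -S1 ler_wpM2r ?(ltW dt0)// ler_nat.
have inp t : m%:R * dt < t < m%:R * dt + dt -> 0 < t < p%:R * dt.
  by move=> /andP[mt tm]; rewrite (le_lt_trans m0 mt) (lt_le_trans tm mp).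
have inm t : m%:R * dt <= t <= m%:R * dt + dt -> in_micro dt m t.
  by rewrite /in_micro S1.
have intE : dintegrand L x m = fun s => L (polynomial_curve X (micro_piece x m) s,
     polynomial_curve X (fun i => (micro_piece x m i)^`()) s).
  by apply/funext => s; rewrite /dintegrand dpositionE dvelocityE.
have Qm t : in_micro dt m t -> Q (polynomial_curve X (micro_piece x m) t).
  by move=> mt; rewrite -dpositionE; exact: xQ.
apply: (quadrature_error ord (S := S)) => //.
- exact: (continuous_subitv cF m0 mp).
- move=> t tm tS; have [_] := dF t (inp t tm) tS.
  have tm' : m%:R * dt <= t <= m%:R * dt + dt by case/andP: tm => /ltW -> /ltW ->.
  (* The rule evaluates the velocity of piece [m] even at the nodes, whereas [z] has this velocity
     only inside the micro interval; that suffices for a primitive. *)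
  have dz : derive1 z t = dvelocity x m t.
    rewrite dvelocityE; have /is_derive1E <- := is_derive_polynomial_curve X (micro_piece x m) t.
    apply: (derive1_eq_interval (a := m%:R * dt) (b := m%:R * dt + dt) _ tm _).2.
      by move=> s sm; rewrite -dpositionE; apply/zE/inm.
    by case: (is_derive_polynomial_curve X (micro_piece x m) t).
  by rewrite dz (zE m t (inm t tm')).
- apply: continuous_in_subspaceT => t; rewrite inE/= in_itv/= intE => tm.
  exact/(polynomial_integrand_continuous Bl Br oQ sU)/Qm/inm.
- move=> k t _ tm; rewrite intE; apply: (polynomial_integrand_derivable Bl Br oQ sU).
  by apply/Qm/inm; case/andP: tm => /ltW -> /ltW ->.
- by move=> t tm; apply: xK; rewrite S1.
Qed.

End DiscreteCurves.

(** Constant pieces that match at the nodes cannot move. For [l = 0] this is what removes the linear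
    term from the comparison curve. *)
Lemma dadmissible_degree0 {R : realType} {ns nf : nat}
    (Q : set ('cV[R]_ns * 'cV[R]_nf)) (p : nat) (dt : R) q0 q1
    (x : @dcurve R ns nf p) :
  (0 < p)%N -> dadmissible Q 0 dt q0 q1 x -> q1 = q0.
Proof.
move=> p0 [[d1 d2 glue] _ [x0 x1]].
have cst_horner (P : {poly R}) (s t : R) : (size P <= 1)%N -> P.[s] = P.[t].
  by move=> /size1_polyC ->; rewrite !hornerC.
have cst_pos (m : 'I_p) (s t : R) : dposition x m s = dposition x m t.
  congr (_, _); apply/matrixP => i j; rewrite !mxE !(ord1 j);
    apply: cst_horner; [exact: d1|exact: d2].
have pos (m : nat) (mp : (m < p)%N) : dposition x (Ordinal mp) 0 = q0.
  elim: m mp => [|m IH] mp; first exact: x0.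
  rewrite -(IH (ltnW mp)) (cst_pos _ 0 (m.+1%:R * dt)) [RHS](cst_pos _ 0 (m.+1%:R * dt)).
  by congr (_, _); rewrite -(glue (Ordinal (ltnW mp)) (Ordinal mp)).
have pp : (p.-1 < p)%N by rewrite prednK.
by rewrite -(pos _ pp) -(x1 (Ordinal pp)) ?prednK//; exact: cst_pos.
Qed.

Lemma open_setX {S T : topologicalType} (A : set S) (B : set T) :
  open A -> open B -> open (A `*` B).
Proof.
rewrite !openE => oA oB [x y] [/= /oA Ax /oB By].
by exists (A, B).
Qed.

Theorem theorem4p3 (R : realType) (ns nf : nat)
  (Qs : set 'cV[R]_ns) (Qf : set 'cV[R]_nf)
  (openQs : open Qs) (openQf : open Qf)
  (Ms : 'M[R]_ns) (Mf : 'M[R]_nf)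
  (V : 'cV[R]_ns * 'cV[R]_nf -> R) (W : 'cV[R]_nf -> R)
  (smoothV : smooth_on (Qs `*` Qf) V) (smoothW : smooth_on Qf W)
  (regularL : regular_lagrangian (Qs `*` Qf) (multirate_lagrangian Ms Mf V W))
  (l r u : nat) (b c : 'I_r -> R)
  (c01 : forall i, 0 <= c i <= 1) (b1 : \sum_(i < r) b i = 1)
  (orderu : quadrature_order b c u)
  (T : R) (T0 : 0 < T) (q : R -> 'cV[R]_ns * 'cV[R]_nf)
  (ELq : EL_solution (Qs `*` Qf) (multirate_lagrangian Ms Mf V W) T q) :
  exists C1 h0 : R, 0 < h0 /\ h0 <= T /\
  forall K : R, exists C2 : R,
  forall (p : nat) (dt : R), (0 < p)%N -> 0 < dt -> p%:R * dt <= h0 ->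
    let L := multirate_lagrangian Ms Mf V W in
    let Q := Qs `*` Qf in
    let DT := p%:R * dt in
    critical_curves_minimise Q L DT (q 0) (q DT) ->
    dcritical_minimise Q L l b c p dt (q 0) (q DT) ->
    integrand_derivative_bounded Q L l b c p dt (q 0) (q DT) u K ->
    forall Ld : R,
    is_discrete_lagrangian Q L l b c p dt (q 0) (q DT) Ld ->
    `| Ld - exact_discrete_lagrangian Q L DT (q 0) (q DT) |
      <= C1 * DT ^+ (2 * l + 1) + C2 * (p%:R * dt ^+ u.+1).
Proof.
have oQ := open_setX openQs openQf.
have Qq0 : (Qs `*` Qf) (q 0) by case: ELq => _ qQ _; apply: qQ; rewrite lexx ltW.
have dualE := mass_dualP Qq0 regularL.
have sU := smooth_onD oQ smoothV (smooth_on_snd Qs smoothW).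
rewrite multirate_natural in ELq *.
move: oQ Qq0 sU ELq; set Q := Qs `*` Qf => oQ Qq0 sU ELq.
have Bl := mass_form_linearl Ms Mf; have Br := mass_form_linearr Ms Mf.
have [Y [M [K' [d [d0 dT YP]]]]] := comparison_curve Bl Br oQ sU dualE l u T0 ELq.
pose Cq := quadrature_constant b.
have Cq0 : 0 <= Cq by exact: quadrature_constant_ge0.
(* The comparison needs a step strictly below [d], whereas a step equal to [h0] is allowed; hence
   the half. *)
exists `|M|, (d / 2); split; first by rewrite divr_gt0.
split; first by apply: le_trans dT; rewrite ler_pdivrMr// ler_peMr ?(ltW d0)// ler1n.
(* [K] serves the quadrature along the critical curve and [K'] the one along the comparison curve;
   the latter was obtained before [K] was given. *)
move=> K; exists (Cq * (`|K| + `|K'|)) => p dt p0 dt0 hd L Q' DT; rewrite /Q' => {Q'}.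
move=> [crit _] [dcrit _] xK Ld [x xcrit ->].
have [admx xmin] := dcrit x xcrit.
have h0 : 0 < DT by rewrite /DT mulr_gt0// ltr0n.
have hd' : DT < d by apply: (le_lt_trans hd); rewrite ltr_pdivrMr// ltr_pMr// ltr1n.
have ELh := EL_solution_restrict (le_trans (ltW hd') dT) ELq.
have [_ qmin] := crit q (EL_critical pair_coordinates Bl Br oQ sU h0 ELh).
(* The solution selected by [get] and [q] are both critical, hence both minimise, and their actions
   are equal. *)
have -> : exact_discrete_lagrangian Q L DT (q 0) (q DT) = action L DT q.
  have [ELg g0 g1] : EL_boundary_solution Q L DT (q 0) (q DT)
      (get [set q' | EL_boundary_solution Q L DT (q 0) (q DT) q']).
    by apply: (@getPex _ [set q' | EL_boundary_solution Q L DT (q 0) (q DT) q']); exists q.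
  rewrite /exact_discrete_lagrangian; move: (get _) ELg g0 g1 => g ELg g0 g1.
  have := EL_critical pair_coordinates Bl Br oQ sU h0 ELg; rewrite g0 g1 => /crit[admg gmin].
  apply/le_anti/andP; split; first exact: (gmin q (EL_admissible h0 ELh)).
  exact: (qmin g admg).
have lq : (0 < l)%N \/ q DT = q 0.
  case: (posnP l) => [l0|]; last by left.
  by right; apply: (dadmissible_degree0 p0); rewrite l0 in admx; exact: admx.
have [sY [Y0 Y1] YQ YK Ycmp] := YP DT (introT andP (conj h0 hd')) lq.
(* The fast component repeats one polynomial on all micro intervals: a curve of degree [l] on the
   macro interval is in particular a continuous micro-piecewise one. *)
pose y : @dcurve R ns nf p :=
  (\col_i Y (inl i) DT, [ffun _ => \col_j Y (inr j) DT]).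
have yE m : micro_piece y m = Y ^~ DT.
  by apply/funext => -[i|i]; rewrite /= ?ffunE mxE.
have in_macro (m : 'I_p) t : in_micro dt m t -> 0 <= t <= DT.
  move=> /andP[mt tm]; rewrite (le_trans _ mt) ?mulr_ge0 ?(ltW dt0)//=.
  by apply: (le_trans tm); rewrite ler_wpM2r ?(ltW dt0)// ler_nat.
have admy : dadmissible Q l dt (q 0) (q DT) y.
  split.
  - split.
    + by move=> i; rewrite mxE.
    + by move=> m i; rewrite ffunE mxE.
    + by move=> m m' _; rewrite !ffunE.
  - by move=> m t /in_macro tm; rewrite dpositionE yE; exact: YQ.
  - by split=> m _; rewrite dpositionE yE.
have [zx [admzx _ zxE]] := discrete_action_error oQ sU orderu c01 p0 dt0 admx
  (K := `|K|) (fun m t mt => le_trans (xK x xcrit m t mt) (ler_norm K)).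
have yK (m : 'I_p) t : m%:R * dt < t < m.+1%:R * dt ->
    `|derive1n u (dintegrand L y m) t| <= `|K'|.
  move=> /andP[mt tm]; apply: (le_trans _ (ler_norm K')).
  have -> : dintegrand L y m = fun s => L (polynomial_curve pair_coordinates (Y ^~ DT) s,
      polynomial_curve pair_coordinates (fun i => (Y i DT)^`()) s).
    by apply/funext => s; rewrite /dintegrand dpositionE dvelocityE yE.
  apply: YK; rewrite (le_lt_trans _ mt) ?mulr_ge0 ?(ltW dt0)//=.
  by apply: (lt_le_trans tm); rewrite ler_wpM2r ?(ltW dt0)// ler_nat.
have [zy [admzy zyy zyE]] := discrete_action_error oQ sU orderu c01 p0 dt0 admy yK.
have zcmp : `|action L DT zy - action L DT q| <= `|M| * DT ^+ (2 * l + 1).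
  apply: (le_trans (Ycmp zy admzy _)).
    move=> t th; have [m mt] := micro_cover p0 th.
    by rewrite (zyy m t mt) dpositionE yE.
  by rewrite ler_wpM2r ?exprn_ge0 ?(ltW h0)// ler_norm.
have qx := qmin zx admzx; have xy := xmin y admy.
move: zxE zyE zcmp; rewrite -/Cq -/DT -/L.
have e0 : 0 <= p%:R * dt ^+ u.+1 by rewrite mulr_ge0 ?exprn_ge0 ?(ltW dt0).
have Kx : 0 <= Cq * `|K| * (p%:R * dt ^+ u.+1) by rewrite mulr_ge0// mulr_ge0.
have Ky : 0 <= Cq * `|K'| * (p%:R * dt ^+ u.+1) by rewrite mulr_ge0// mulr_ge0.
have Mh : 0 <= `|M| * DT ^+ (2 * l + 1) by rewrite mulr_ge0 ?exprn_ge0 ?(ltW h0).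
have -> : Cq * (`|K| + `|K'|) * (p%:R * dt ^+ u.+1) =
  Cq * `|K| * (p%:R * dt ^+ u.+1) + Cq * `|K'| * (p%:R * dt ^+ u.+1) by ring.
(* What is left is linear arithmetic in five actions: the two minimality inequalities, the two
   quadrature errors and the gap between [zy] and [q]. *)
move: qx xy Kx Ky Mh.
move: (_ * _ * (p%:R * _)) (_ * _ * (p%:R * _)) (`|M| * _) => ex ey eM.
move: (action _ _ zx) (action _ _ zy) (action _ _ q) (discrete_action _ _ _ _ x)
  (discrete_action _ _ _ _ y) => a1 a2 a3 a4 a5.
rewrite !ler_norml => ? ? ? ? ? /andP[? ?] /andP[? ?] /andP[? ?].
by apply/andP; split; lra.
Qed.
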